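(* Let $\lambda>4$. For $n\in\mathbb{N}$ let $g_n$ be the staircase function $$g_n(x):=\frac in\quad\text{if }\frac{i-1}n\le x<\frac in,\quad i=1,\dots,n,$$ and let $u_n$ be the unique minimizer in $BV((0,1))$ of $$\mathrm{ROF}_{\lambda,g_n}(w):=|w'|((0,1))+\lambda\int_0^1(w-g_n)^2\,dx.$$ Then for all $n$ sufficiently large there exist $0<a_n<b_n<1$, with $$a_n\to\frac1{\sqrt\lambda},\qquad b_n\to1-\frac1{\sqrt\lambda}\qquad\text{as }n\to\infty,$$ such that $u_n=g_n$ on $[a_n,b_n]$ and $u_n$ is constant on each of the intervals $[0,a_n)$ and $(b_n,1]$.
   Context: $BV((0,1))$ is the space of functions of bounded variation, whose elements are equivalence classes up to $\mathcal{L}^1$-a.e. equality (so the identities for $u_n$ are understood $\mathcal{L}^1$-a.e.), and $|w'|((0,1))$ is the total variation of the distributional derivative $w'$ of $w$. *)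

(* Defs.v *)
From HB Require Import structures.
From mathcomp Require Import all_boot all_order all_algebra.
From mathcomp Require Import all_classical all_reals all_analysis.

Set Implicit Arguments.
Unset Strict Implicit.
Unset Printing Implicit Defensive.
Import Order.TTheory GRing.Theory Num.Theory.
Import numFieldNormedType.Exports.

Local Open Scope ring_scope.
Local Open Scope classical_set_scope.

(* A finite signed Borel measure on (0,1) is represented by a charge on R, of
   which only the restriction to `]0, 1[ is ever used. *)
Notation signed_measure R := ({charge set (measurableTypeR R) -> \bar R}%type).

Section SignedMeasures.
Variable R : realType.
Implicit Type nu : signed_measure R.

(* The Jordan parts, hence all that follows, do not depend on the choice of a
   Hahn decomposition. *)
Definition hahn_pos nu : set (measurableTypeR R) :=
  projT1 (cid (Hahn_decomposition nu)).

Definition hahn_neg nu : set (measurableTypeR R) :=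
  projT1 (cid (projT2 (cid (Hahn_decomposition nu)))).

Definition hahnP nu : hahn_decomposition nu (hahn_pos nu) (hahn_neg nu) :=
  projT2 (cid (projT2 (cid (Hahn_decomposition nu)))).

Definition total_variation_charge nu (A : set R) : \bar R := charge_variation (hahnP nu) A.

Definition charge_integral nu (A : set R) (f : R -> R) : \bar R :=
  (\int[jordan_pos (hahnP nu)]_(x in A) (f x)%:E -
   \int[jordan_neg (hahnP nu)]_(x in A) (f x)%:E)%E.

End SignedMeasures.

Section BoundedVariation.
Variable R : realType.

Definition smooth (phi : R -> R) : Prop :=
  forall (k : nat) (x : R), derivable phi^`(k) x 1.

Definition compactly_supported (A : set R) (phi : R -> R) : Prop :=
  compact (closure [set x | phi x != 0]) /\
  closure [set x | phi x != 0] `<=` A.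

Definition distributional_derivative (w : R -> R) (nu : signed_measure R) :
    Prop :=
  forall phi : R -> R, smooth phi -> compactly_supported `]0, 1[ phi ->
    (\int[lebesgue_measure]_(x in `]0%R, 1%R[) (w x * (phi^`())%classic x)%:E =
     - charge_integral nu `]0%R, 1%R[ phi)%E.

(* An element of BV((0,1)) is given by a representative, defined on all of R
   but with irrelevant values off `]0, 1[, together with its distributional
   derivative, which on `]0, 1[ is determined by the representative. *)
Record BV01 := MkBV01 {
  bv_fun :> R -> R ;
  bv_deriv : signed_measure R ;
  bv_integrable : (@lebesgue_measure R).-integrable `]0, 1[ (EFin \o bv_fun) ;
  bv_derivP : distributional_derivative bv_fun bv_deriv }.

(* Equality in BV((0,1)), of functions as classes. *)
Definition bv_eq (v w : BV01) : Prop :=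
  {ae (@lebesgue_measure R), forall x : R, 0 < x -> x < 1 -> v x = w x}.

Definition ROF (lambda : R) (g : R -> R) (w : BV01) : \bar R :=
  (total_variation_charge (bv_deriv w) `]0%R, 1%R[ +
   lambda%:E * \int[lebesgue_measure]_(x in `]0%R, 1%R[)
     ((w x - g x) ^+ 2)%:E)%E.

Definition ROF_minimizer (lambda : R) (g : R -> R) (u : BV01) : Prop :=
  forall w : BV01, (ROF lambda g u <= ROF lambda g w)%E.

Definition staircase (n : nat) (x : R) : R :=
  \sum_(1 <= i < n.+1)
    i%:R / n%:R * \1_(`[i.-1%:R / n%:R, i%:R / n%:R[ : set R) x.

End BoundedVariation.

(* Main.v *)
Require Import Defs.
From HB Require Import structures.
From mathcomp Require Import all_boot all_order all_algebra.
From mathcomp Require Import all_classical all_reals all_analysis.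
From mathcomp Require Import measurable_realfun ring lra.

Set Implicit Arguments.
Unset Strict Implicit.
Unset Printing Implicit Defensive.
Import Order.TTheory GRing.Theory Num.Theory.
Import numFieldNormedType.Exports.

Local Open Scope ring_scope.
Local Open Scope classical_set_scope.

(* The minimizer is the truncation of g_n between two levels alpha and beta, by
   a calibration argument. If z is Lipschitz, z(0) = z(1) = 0, |z| <= 1, z = 1
   where u jumps and z' = 2 lambda (u - g), then for every w in BV
     |w'|((0,1)) >= - \int z' w   and   |u'|((0,1)) = - \int z' u,
   and completing the square gives
     ROF(w) >= ROF(u) + lambda \int (w - u)^2,
   i.e. minimality and uniqueness at once. The first inequality is the definition
   of w' when z is a test function, and passes to piecewise linear z by smoothing
   its kinks and dominated convergence.
   For u = max(alpha, min(g_n, beta)) with beta = 1 + 1/n - alpha, the field z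
   rises from 0 to 1 where u = alpha, stays at 1 where u = g_n and decreases to 0
   where u = beta, provided that 2 lambda \int (alpha - g_n)^+ = 1. If this
   forces alpha > beta, the constant mean value is the minimizer. With
   k / n <= alpha <= (k + 1) / n the condition on alpha amounts to
   lambda k (k - 1) <= n^2 <= lambda k (k + 1), so that k / n tends to
   1 / sqrt lambda. *)

(** * Smooth transition functions *)

Section Smoothness.
Variable R : realType.
Implicit Types f g : R -> R.

(** Derivatives are carried as explicit witnesses, so that closure under sums, products, inverses
    and affine substitutions is a plain induction; [smooth] speaks of the iterated derivatives of
    one fixed function instead. *)
Fixpoint Cn (n : nat) f : Prop :=
  if n is n'.+1 then
    exists2 f' : R -> R, (forall x : R, is_derive x 1 f (f' x)) & Cn n' f'
  else True.

Lemma Cn_smooth f : (forall n, Cn n f) -> smooth f.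
Proof.
move=> Cf k x; have := Cf k.+1; elim: k f {Cf} x => [|k IH] f x.
  by case=> f' df _; exact: ex_derive.
case=> f' df Cf'; rewrite derive1Sn.
have -> : f^`()%classic = f' by apply/funext => y; rewrite derive1E derive_val.
exact: IH.
Qed.

Lemma CnW n f : Cn n.+1 f -> Cn n f.
Proof.
by elim: n f => // n IH f [f' df] /IH Cf'; exists f'.
Qed.

Lemma Cn_cst n c : Cn n (cst c).
Proof.
by elim: n c => // n IH c; exists (cst 0) => // x; exact: is_derive_cst.
Qed.

Lemma Cn_id n : Cn n id.
Proof.
by case: n => // n; exists (cst 1); [move=> x; exact: is_derive_id|exact: Cn_cst].
Qed.

Lemma CnD n f g : Cn n f -> Cn n g -> Cn n (fun x => f x + g x).
Proof.
elim: n f g => // n IH f g [f' df Cf] [g' dg Cg].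
by exists (fun x => f' x + g' x); [move=> x; exact: is_deriveD|exact: IH].
Qed.

Lemma CnM n f g : Cn n f -> Cn n g -> Cn n (fun x => f x * g x).
Proof.
elim: n f g => // n IH f g Cf Cg.
have [[f' df Cf'] [g' dg Cg']] := (Cf, Cg).
exists (fun x => f x * g' x + g x * f' x).
  by move=> x; exact: is_deriveM.
by apply: CnD; apply: IH => //; exact: CnW.
Qed.

Lemma CnZ n c f : Cn n f -> Cn n (fun x => c * f x).
Proof. by apply: CnM; exact: Cn_cst. Qed.

(** The derivative is - f' / f^2, in which 1 / f is needed only to the order supplied by the
    induction. *)
Lemma CnV n f : (forall x, f x != 0) -> Cn n f -> Cn n (fun x => (f x)^-1).
Proof.
move=> f0; elim: n => // n IH Cf; have [f' df Cf'] := Cf.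
exists (fun x => - 1 * (f' x * ((f x)^-1 * (f x)^-1))).
  move=> x; apply: (is_derive_eq (is_deriveV (f0 x) (df x))).
  by rewrite /GRing.scale/= -expr2 exprVn; ring.
have CV := IH (CnW Cf).
by apply: CnZ; apply: CnM => //; exact: CnM.
Qed.

Lemma is_derive_affine f (a b x df : R) :
  is_derive (a * x + b) 1 f df -> is_derive x 1 (fun t => f (a * t + b)) (a * df).
Proof.
move=> Hf.
have Hg : is_derive x 1 (fun t : R => a * t + b) a.
  have -> : (fun t : R => a * t + b) = (a \*: id) \+ cst b by [].
  by apply: is_derive_eq; rewrite addr0 /GRing.scale/= mulr1.
apply: (is_derive_eq (@is_derive1_comp _ f (fun t => a * t + b) x _ _ Hf Hg)).
by rewrite mulrC.
Qed.

Lemma Cn_affine n f (a b : R) : Cn n f -> Cn n (fun x => f (a * x + b)).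
Proof.
elim: n f => // n IH f [f' df Cf'].
exists (fun x => a * f' (a * x + b)); last exact/CnZ/IH.
by move=> x; exact: is_derive_affine.
Qed.

Lemma Cn_sum n (I : Type) (r : seq I) (F : I -> R -> R) :
  (forall i, Cn n (F i)) -> Cn n (fun x => \sum_(i <- r) F i x).
Proof.
move=> CF; elim: r => [|i r IH].
  suff -> : (fun x => \sum_(i <- [::]) F i x) = cst 0 by exact: Cn_cst.
  by apply/funext => x; rewrite big_nil.
suff -> : (fun x => \sum_(i <- i :: r) F i x) =
          (fun x => F i x + \sum_(i <- r) F i x) by exact: CnD.
by apply/funext => x; rewrite big_cons.
Qed.

(* The functions p(1/x) exp(-1/x) form a class stable under derivation, whence
   the smoothness of exp(-1/x) at 0. *)
Definition expVp (p : {poly R}) (x : R) : R :=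
  if 0 < x then p.[x^-1] * expR (- x^-1) else 0.

Lemma horner_le (p : {poly R}) : exists2 M : R, 0 <= M &
  forall y, 1 <= y -> `|p.[y]| <= M * y ^+ size p.
Proof.
exists (\sum_(i < size p) `|p`_i|) => [|y y1]; first by apply: sumr_ge0.
rewrite horner_coef mulr_suml; apply: le_trans (ler_norm_sum _ _ _) _.
apply: ler_sum => i _; rewrite normrM ler_wpM2l//.
rewrite ger0_norm ?exprn_ge0//; last by lra.
by apply: ler_weXn2l => //; exact: ltnW.
Qed.

(** With y = 1 / x, the term of degree [size p + 2] in the exponential series beats the growth
    y^(size p) of p by two powers, which leaves the factor x^2. *)
Lemma expVp_le (p : {poly R}) : exists2 M : R, 0 <= M &
  forall x, 0 < x -> x < 1 -> `|expVp p x| <= M * x ^+ 2.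
Proof.
have [M M0 HM] := horner_le p.
pose d := (size p).+1; exists (M * d.+1`!%:R) => [|x x0 x1].
  by rewrite mulr_ge0.
rewrite /expVp x0 normrM (gtr0_norm (expR_gt0 _)) expRN.
have y1 : 1 <= x^-1 by rewrite -[leLHS]invr1 lef_pV2 ?posrE ?ltr01// ltW.
have y0 : 0 < x^-1 by rewrite invr_gt0.
rewrite ler_pdivrMr ?expR_gt0//.
apply: le_trans (HM _ y1) _; rewrite -!mulrA ler_wpM2l//.
have := expR_ge1Dxn d (ltW y0) => H.
have {}H : x^-1 ^+ d.+1 / d.+1`!%:R <= expR x^-1 by apply: le_trans H; lra.
have f0 : 0 < d.+1`!%:R :> R by rewrite ltr0n fact_gt0.
move: H; rewrite ler_pdivrMr// => H.
apply: (@le_trans _ _ (x ^+ 2 * x^-1 ^+ d.+1)).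
  by rewrite /d !exprS expr0; set y := x^-1 ^+ _; rewrite le_eqVlt; apply/orP;
    left; apply/eqP; field; rewrite gt_eqF.
apply: le_trans (ler_wpM2l (exprn_ge0 2 (ltW x0)) H) _.
by rewrite le_eqVlt; apply/orP; left; apply/eqP; ring.
Qed.

Lemma is_derive0_le_sqr f (M : R) : f 0 = 0 ->
  (forall x, `|x| < 1 -> `|f x| <= M * x ^+ 2) -> is_derive (0 : R) 1 f 0.
Proof.
move=> f0 fM.
have H : (fun h : R => h^-1 *: ((f \o shift 0) (h *: 1) - f 0)) @ 0^' --> (0 : R).
  apply/cvgrPdist_le => e e0.
  have M0 : 0 <= M.
    have h1 : `|2^-1 : R| < 1 by rewrite ger0_norm; lra.
    by have := le_trans (normr_ge0 _) (fM _ h1); rewrite pmulr_lge0// exprn_gt0.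
  near=> h.
  have h0 : h != 0 by near: h; exact: nbhs_dnbhs_neq.
  have h1 : `|h| < 1.
    by near: h; apply: dnbhs0_lt.
  (* M may vanish, hence the denominator M + 1. *)
  have h2 : `|h| <= e / (M + 1).
    by near: h; apply: dnbhs0_le; rewrite divr_gt0//; lra.
  rewrite sub0r normrN f0 subr0 /= addr0 /GRing.scale/= mulr1 normrM normfV.
  have h0' : 0 < `|h| by rewrite normr_gt0.
  rewrite mulrC ler_pdivrMr//; apply: le_trans (fM _ h1) _.
  rewrite -real_normK ?num_real// expr2 mulrA ler_wpM2r//.
  move: h2; rewrite ler_pdivlMr; last by lra.
  by apply: le_trans; rewrite mulrC ler_wpM2l//; lra.
by split; [apply/cvg_ex; exists 0|exact/cvg_lim].
Unshelve. all: by end_near. Qed.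

(** For x > 0 this is the chain rule, as y = 1 / x has derivative - y^2. At 0 the quadratic bound
    [expVp_le] makes the difference quotient vanish. *)
Lemma is_derive_expVp (p : {poly R}) (x : R) :
  is_derive x 1 (expVp p) (expVp ('X^2 * (p - p^`())) x).
Proof.
have [x0|x0|->] := ltgtP x 0.
- rewrite {2}/expVp ltNge (ltW x0)/=.
  apply: (@near_eq_is_derive _ _ _ (cst 0)).
  by near=> y; rewrite /expVp /= ltNge (_ : y <= 0)//; near: y;
    apply: filterS (lt_nbhsl x0) => y /ltW.
- rewrite {2}/expVp x0.
  have dV : is_derive x 1 (fun x : R => x^-1) (- x ^- 2).
    apply: (is_derive_eq (@is_deriveV _ id x 1 1 (lt0r_neq0 x0) _)).
    by rewrite /GRing.scale/= mulr1.
  have dp : is_derive x 1 (fun x : R => p.[x^-1]) (p^`().[x^-1] * - x ^- 2).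
    exact: (@is_derive1_comp _ (horner p)).
  have de : is_derive x 1 (fun x : R => expR (- x^-1)) (expR (- x^-1) * x ^- 2).
    have dN : is_derive x 1 (fun x : R => - x^-1) (x ^- 2).
      by rewrite -[x ^- 2]opprK; exact: is_deriveN.
    exact: (@is_derive1_comp _ expR (fun x : R => - x^-1) _ _ _ _ dN).
  suff H : is_derive x 1 (fun x : R => p.[x^-1] * expR (- x^-1))
      (('X^2 * (p - p^`())).[x^-1] * expR (- x^-1)).
    apply: near_eq_is_derive H.
    by near=> y; rewrite /expVp /= (_ : 0 < y)//; near: y; exact: lt_nbhsr.
  apply: (is_derive_eq (is_deriveM dp de)).
  rewrite hornerM hornerXn hornerD hornerN -exprVn.
  change (p.[x^-1] * (expR (- x^-1) * x^-1 ^+ 2) +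
          expR (- x^-1) * (p^`().[x^-1] * - x^-1 ^+ 2) =
          x^-1 ^+ 2 * (p.[x^-1] - p^`().[x^-1]) * expR (- x^-1)).
  by ring.
- rewrite {2}/expVp ltxx; have [M M0 HM] := expVp_le p.
  apply: (@is_derive0_le_sqr _ M); first by rewrite /expVp ltxx.
  move=> y; rewrite ltr_norml => /andP[_ y1].
  have [y0|y0] := ltP 0 y; first exact: HM.
  by rewrite /expVp ltNge y0/= normr0 mulr_ge0// sqr_ge0.
Unshelve. all: by end_near. Qed.

Lemma Cn_expVp n (p : {poly R}) : Cn n (expVp p).
Proof.
elim: n p => // n IH p; exists (expVp ('X^2 * (p - p^`()))) => //.
by move=> x; exact: is_derive_expVp.
Qed.

Definition flat (x : R) : R := expVp 1 x.

Lemma flat_ge0 x : 0 <= flat x.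
Proof. by rewrite /flat /expVp; case: ifP => // _; rewrite hornerE mul1r expR_ge0. Qed.

Lemma flat_gt0 x : 0 < x -> 0 < flat x.
Proof. by move=> x0; rewrite /flat /expVp x0 hornerE mul1r expR_gt0. Qed.

Lemma flat_eq0 x : x <= 0 -> flat x = 0.
Proof. by rewrite /flat /expVp ltNge => ->. Qed.

(** The usual smooth step from 0 to 1 across [0, 1]; 1 - x is spelt [- 1 * x + 1] to match
    [Cn_affine]. *)
Definition transition (x : R) : R := flat x / (flat x + flat (- 1 * x + 1)).

Lemma transition_den_gt0 x : 0 < flat x + flat (- 1 * x + 1).
Proof.
have [x0|x0] := ltP 0 x.
  by have := flat_gt0 x0; have := flat_ge0 (- 1 * x + 1); lra.
have : 0 < flat (- 1 * x + 1) by apply: flat_gt0; lra.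
by have := flat_ge0 x; lra.
Qed.

Lemma Cn_transition n : Cn n transition.
Proof.
apply: CnM; first exact: Cn_expVp.
apply: CnV; first by move=> x; rewrite gt_eqF// transition_den_gt0.
by apply: CnD; [|apply: Cn_affine]; exact: Cn_expVp.
Qed.

Lemma transition_ge0 x : 0 <= transition x.
Proof. by rewrite divr_ge0 ?flat_ge0// ltW// transition_den_gt0. Qed.

Lemma transition_le1 x : transition x <= 1.
Proof.
by rewrite ler_pdivrMr ?transition_den_gt0// mul1r lerDl flat_ge0.
Qed.

Lemma transition_eq0 x : x <= 0 -> transition x = 0.
Proof. by move=> x0; rewrite /transition flat_eq0// mul0r. Qed.

Lemma transition_eq1 x : 1 <= x -> transition x = 1.
Proof.
move=> x1; rewrite /transition (@flat_eq0 (- 1 * x + 1)) ?addr0; last by lra.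
by rewrite divff// gt_eqF// flat_gt0//; lra.
Qed.

End Smoothness.

(** * Smoothing piecewise linear functions *)

Section PiecewiseLinear.
Variable R : realType.

Lemma Cn_continuous (f : R -> R) : Cn 1 f -> continuous f.
Proof.
case=> f' df _ x; apply/differentiable_continuous/derivable1_diffP.
exact: ex_derive.
Qed.

Lemma continuous_bigsum (I : Type) (r : seq I) (F : I -> R -> R) :
  (forall i, continuous (F i)) -> continuous (fun x => \sum_(i <- r) F i x).
Proof.
move=> cF; elim: r => [|i r IH] x.
  by under eq_fun do rewrite big_nil; exact: cvg_cst.
under eq_fun do rewrite big_cons.
by apply: cvgD; [exact: cF|exact: IH].
Qed.

(** The transition is constant on either side of [0, 1], so its continuous derivative vanishes
    there, and the extreme value theorem on [0, 1] bounds it globally. *)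
Lemma transition_derivative : exists (f : R -> R) (M : R),
  [/\ forall x : R, is_derive x 1 (@transition R) (f x), continuous f,
      forall t : R, `|f t| <= M & forall t : R, (t < 0) || (1 < t) -> f t = 0].
Proof.
have [f df Cf] := @Cn_transition R 2.
have cf := Cn_continuous Cf.
have cnf : {within `[0, 1], continuous (fun t => `|f t|)}.
  apply: continuous_subspaceT => x.
  by apply: continuous_comp; [exact: cf|exact: norm_continuous].
have [c _ cmax] := EVT_max ler01 cnf.
have fE (t l : R) : is_derive t 1 (@transition R) l -> f t = l.
  move=> dl; have dt := df t.
  by rewrite -(@derive_val _ _ _ _ _ _ _ dt) (@derive_val _ _ _ _ _ _ _ dl).
have f0 (t : R) : (t < 0) || (1 < t) -> f t = 0.
  move=> /orP[t0|t1]; apply: fE.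
    apply: near_eq_is_derive (is_derive_cst (0 : R) t 1).
    by near=> y; rewrite transition_eq0//; near: y;
      apply: filterS (lt_nbhsl t0) => y /ltW.
  apply: near_eq_is_derive (is_derive_cst (1 : R) t 1).
  by near=> y; rewrite transition_eq1//; near: y;
    apply: filterS (lt_nbhsr t1) => y /ltW.
exists f, `|f c|; split => // t.
have [t01|] := boolP (t \in `[0, 1]%R); first exact: cmax.
by rewrite in_itv/= negb_and -!ltNge => /f0 ->; rewrite normr0.
Unshelve. all: by end_near. Qed.

(** A smooth stand-in for the positive part of x. The kink is spread over the window from [- c * e]
    to [(1 - c) * e], which c moves to either side of 0. *)
Definition ramp (e c x : R) := x * transition (e^-1 * x + c).

Lemma Cn_ramp n e c : Cn n (ramp e c).
Proof. by apply: CnM; [exact: Cn_id|apply: Cn_affine; exact: Cn_transition]. Qed.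

Lemma ramp_approx (e c x : R) : 0 < e -> -1 <= c <= 2 ->
  `|ramp e c x - Num.max 0 x| <= 2 * e.
Proof.
move=> e0 /andP[c1 c2]; rewrite /ramp; set t := e^-1 * x + c.
have ge0 := transition_ge0 t; have le1 := transition_le1 t.
have [x0|x0] := lerP 0 x.
- have [x2|x2] := lerP (2 * e) x.
    rewrite transition_eq1 ?mulr1 ?subrr ?normr0; first by lra.
    have : 2 <= e^-1 * x by rewrite mulrC ler_pdivlMr.
    by rewrite /t; lra.
  by rewrite ler_norml; apply/andP; split; nra.
- rewrite subr0 ler_norml; have [x2|x2] := lerP x (- (2 * e)).
    rewrite transition_eq0 ?mulr0; first by apply/andP; split; lra.
    have : e^-1 * x <= - 2 by rewrite mulrC ler_pdivrMr//; lra.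
    by rewrite /t; lra.
  by apply/andP; split; nra.
Qed.

Lemma ramp_eq0 (e c x : R) : 0 < e -> x <= - c * e -> ramp e c x = 0.
Proof.
move=> e0 xc; rewrite /ramp transition_eq0 ?mulr0//.
have : e^-1 * x <= - c by rewrite mulrC ler_pdivrMr.
lra.
Qed.

Lemma ramp_eqx (e c x : R) : 0 < e -> (1 - c) * e <= x -> ramp e c x = x.
Proof.
move=> e0 xc; rewrite /ramp transition_eq1 ?mulr1//.
have : 1 - c <= e^-1 * x by rewrite mulrC ler_pdivlMr.
lra.
Qed.

(** The derivative contains x / e times that of [transition], and [|x| <= 2 * e] wherever this term
    is nonzero. So the bound is uniform in e, although the kink sharpens as e tends to 0. *)
Lemma ramp_derivative : exists (f : R -> R -> R -> R) (M : R),
  0 <= M /\ forall e c, 0 < e -> -1 <= c <= 2 ->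
  [/\ forall x : R, is_derive x 1 (ramp e c) (f e c x),
      continuous (f e c),
      forall x, `|f e c x| <= M &
      forall x, 2 * e < `|x| -> f e c x = (0 <= x)%R%:R].
Proof.
have [g [M [dg cg gM g0]]] := transition_derivative.
have M0 : 0 <= M by apply: le_trans (gM 0).
exists (fun e c x => transition (e^-1 * x + c) + e^-1 * x * g (e^-1 * x + c)).
exists (1 + 2 * M); split => [|e c e0 /andP[c1 c2]]; first by lra.
have big (x : R) : 2 * e < `|x| -> e^-1 * x < - 2 \/ 2 < e^-1 * x.
  rewrite ltr_normr => /orP[] xe; [right|left].
    by rewrite mulrC ltr_pdivlMr.
  by rewrite mulrC ltr_pdivrMr//; lra.
have caff : continuous (fun x : R => e^-1 * x + c).
  by move=> x; apply: cvgD; [apply: cvgM;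
    [exact: cvg_cst|exact: cvg_id]|exact: cvg_cst].
split.
- move=> x.
  have H := is_derive_affine (dg (e^-1 * x + c)).
  have := is_deriveM (is_derive_id x 1) H.
  by move=> /is_derive_eq; apply; rewrite /GRing.scale/= mulr1; ring.
- move=> x; apply: cvgD.
    apply: (@continuous_comp _ _ _ (fun x : R => e^-1 * x + c) (@transition R)).
      exact: caff.
    exact/Cn_continuous/Cn_transition.
  apply: cvgM; first by apply: cvgM; [exact: cvg_cst|exact: cvg_id].
  by apply: (@continuous_comp _ _ _ (fun x : R => e^-1 * x + c) g);
    [exact: caff|exact: cg].
- move=> x; set t := e^-1 * x + c.
  have ge0 := transition_ge0 t; have le1 := transition_le1 t.
  apply: le_trans (ler_normD _ _) _; rewrite ger0_norm// normrM.
  apply: lerD => //; have [|/big xe] := lerP `|x| (2 * e).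
    move=> x2; apply: ler_pM => //.
    by rewrite normrM normfV (gtr0_norm e0) mulrC ler_pdivrMr.
  by rewrite g0 ?normr0 ?mulr0 ?mulr_ge0//; apply/orP; rewrite /t; case: xe => ?;
    [left|right]; lra.
- move=> x /[dup] xe /big H; rewrite g0 ?mulr0 ?addr0; last first.
    by apply/orP; case: H => ?; [left|right]; lra.
  case: H => H.
    have x0 : x < 0 by rewrite -(pmulr_rlt0 x (_ : 0 < e^-1)) ?invr_gt0//; lra.
    by rewrite leNgt x0/= transition_eq0//; lra.
  have x0 : 0 < x by rewrite -(pmulr_rgt0 x (_ : 0 < e^-1)) ?invr_gt0//; lra.
  by rewrite ltW// transition_eq1//; lra.
Qed.

Variables (n : nat) (k : nat -> R).
Hypothesis n0 : (0 < n)%N.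

Definition node (j : nat) : R := j%:R / n%:R.

(** The coefficient [k j] is the change at node j. Such sums encode step functions like u and g, and
    also the derivative, off the nodes, of the piecewise linear [kinks n k]. *)
Definition steps (x : R) : R := \sum_(j < n.+1) k j * (node j <= x)%R%:R.

Definition kinks (x : R) : R := \sum_(j < n.+1) k j * Num.max 0 (x - node j).

Definition side (j : nat) : R := if (j < n)%N then -1 else 2.

(* The last kink is smoothed to the left of its node and all others to the
   right, so that the support stays away from 0 and 1. *)
Definition smooth_kinks (e x : R) : R :=
  \sum_(j < n.+1) k j * ramp e (side j) (1 * x + - node j).

Let shift_ok (j : nat) : -1 <= side j <= 2.
Proof. by rewrite /side; case: ifP => _; apply/andP; split; lra. Qed.

Lemma Cn_smooth_kinks e m : Cn m (smooth_kinks e).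
Proof.
apply: (@Cn_sum _ _ _ _ (fun (j : 'I_n.+1) x => k j * ramp e (side j) (1 * x +
  - node j))) => j.
by apply: CnZ; apply: Cn_affine; exact: Cn_ramp.
Qed.

Lemma smooth_kinks_approx e x : 0 < e ->
  `|smooth_kinks e x - kinks x| <= (\sum_(j < n.+1) `|k j|) * (2 * e).
Proof.
move=> e0; rewrite -sumrB mulr_suml; apply: le_trans (ler_norm_sum _ _ _) _.
apply: ler_sum => j _; rewrite -mulrBr normrM mul1r ler_wpM2l//.
exact: ramp_approx.
Qed.

(** Prepared for dominated convergence: one bound serves all e, and at a point that is not a node
    the slope is exact once e is small. *)
Lemma smooth_kinks_derivative : exists (f : R -> R -> R) (M : R),
  forall e, 0 < e ->
  [/\ forall x : R, is_derive x 1 (smooth_kinks e) (f e x),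
      continuous (f e),
      forall x, `|f e x| <= M &
      forall x, (forall j, (j <= n)%N -> 2 * e < `|x - node j|) -> f e x = steps x].
Proof.
have [g [M [M0 gP]]] := ramp_derivative.
exists (fun e x => \sum_(j < n.+1) k j * g e (side j) (1 * x + - node j)).
exists ((\sum_(j < n.+1) `|k j|) * M) => e e0; split.
- move=> x; have -> : smooth_kinks e =
      \sum_(j < n.+1) (fun x => k j * ramp e (side j) (1 * x + - node j)).
    by apply/funext => y; rewrite fct_sumE.
  apply: is_derive_sum => j; have [dr _ _ _] := gP e _ e0 (shift_ok j).
  have := is_deriveZ (k j) (is_derive_affine (dr (1 * x + - node j))).
  by move=> /is_derive_eq; apply; rewrite mul1r.
- apply: continuous_bigsum => j x; have [_ cr _ _] := gP e _ e0 (shift_ok j).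
  apply: cvgM; first exact: cvg_cst.
  apply: (@continuous_comp _ _ _ (fun x : R => 1 * x + - node j) (g e (side j))).
    by apply: cvgD; [apply: cvgM; [exact: cvg_cst|exact: cvg_id]|exact: cvg_cst].
  exact: cr.
- move=> x; rewrite mulr_suml; apply: le_trans (ler_norm_sum _ _ _) _.
  apply: ler_sum => j _; rewrite normrM ler_wpM2l//.
  by have [_ _ gle _] := gP e _ e0 (shift_ok j); exact: gle.
- move=> x xj; apply: eq_bigr => j _; rewrite mul1r.
  have [_ _ _ H] := gP e _ e0 (shift_ok j).
  by rewrite H ?subr_ge0// xj// -ltnS.
Qed.

Hypothesis k0 : \sum_(j < n.+1) k j = 0.
Hypothesis k1 : \sum_(j < n.+1) k j * node j = 0.

(** Near 0 every ramp is still off. Near 1 every ramp is fully on, so that the sum is affine in x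
    with coefficients given by [k0] and [k1], both zero. The condition on e keeps the smoothing
    windows inside their cells. *)
Lemma smooth_kinks_eq0 e x : 0 < e -> 4 * e <= n%:R^-1 ->
  (x <= e) || (1 - e <= x) -> smooth_kinks e x = 0.
Proof.
move=> e0 en; have n0' : 0 < n%:R :> R by rewrite ltr0n.
have n1 : n%:R^-1 <= 1 :> R by rewrite invf_le1// ler1n.
have node_ge0 j : 0 <= node j by rewrite divr_ge0.
have noden : node n = 1 by rewrite /node divff// gt_eqF.
have ltn j : (j < n)%N -> node j <= 1 - n%:R^-1.
  move=> jn; have -> : 1 - n%:R^-1 = (n%:R - 1) / n%:R :> R by field; rewrite gt_eqF.
  by rewrite ler_wpM2r ?invr_ge0// lerBrDr natr1 ler_nat.
have jn (j : 'I_n.+1) : (j < n)%N = false -> j = n :> nat.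
  move=> /negbT; rewrite -leqNgt => nj; apply/eqP; rewrite eqn_leq nj.
  by rewrite andbT -ltnS ltn_ord.
move=> /orP[xe|xe].
  apply: big1 => j _; rewrite ramp_eq0 ?mulr0// /side; case: ifPn => [_|/negbTE/jn ->].
    by have := node_ge0 j; lra.
  by rewrite noden; lra.
transitivity (x * (\sum_(j < n.+1) k j) - \sum_(j < n.+1) k j * node j); last first.
  by rewrite k0 k1 mulr0 subr0.
rewrite mulr_sumr -sumrB.
apply: eq_bigr => j _; rewrite ramp_eqx//; first by ring.
rewrite /side; case: ifPn => [/ltn|/negbTE/jn ->]; last by rewrite noden; lra.
by lra.
Qed.

Lemma smooth_kinks_supported e : 0 < e -> 4 * e <= n%:R^-1 ->
  compactly_supported `]0, 1[ (smooth_kinks e).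
Proof.
move=> e0 en.
have sub : closure [set x | smooth_kinks e x != 0] `<=` `[e, 1 - e].
  rewrite [X in _ `<=` X](_ : _ = closure `[e, 1 - e]).
    apply: closure_subset => x /= nz; change (is_true (x \in `[e, 1 - e]%R)).
    apply: contraNT nz; rewrite in_itv/= negb_and -!ltNge.
    move=> H; apply/eqP/smooth_kinks_eq0 => //.
    by case/orP: H => /ltW ->; rewrite ?orbT.
  by apply/closure_id; exact: itv_closed.
split.
  apply: (subclosed_compact _ _ sub); first exact: closed_closure.
  exact: segment_compact.
move=> x /sub; rewrite /= !in_itv/=; lra.
Qed.

End PiecewiseLinear.

(** * Piecewise linear fields bound the total variation from below *)

Section TotalVariation.
Variable R : realType.
Implicit Types (nu : signed_measure R) (A : set R).
Local Notation mu := (@lebesgue_measure R).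
Local Notation I01 := (`]0, 1[%classic : set R).

Lemma total_variation_charge_fin_num nu A : measurable A ->
  total_variation_charge nu A \is a fin_num.
Proof.
move=> mA; rewrite /total_variation_charge /charge_variation/= fin_numD.
by apply/andP; split; exact: fin_num_measure.
Qed.

Lemma total_variation_charge_ge0 nu A : (0 <= total_variation_charge nu A)%E.
Proof. by rewrite /total_variation_charge /charge_variation/= adde_ge0. Qed.

Lemma charge_integral_le nu A (phi : R -> R) (M : R) : measurable A ->
  measurable_fun setT phi -> (forall x, `|phi x| <= M) ->
  (`|charge_integral nu A phi| <= M%:E * total_variation_charge nu A)%E.
Proof.
move=> mA mphi phiM; have M0 : 0 <= M by exact: le_trans (phiM 0).
have bnd (m : {measure set (measurableTypeR R) -> \bar R}) :
    (`|\int[m]_(x in A) (phi x)%:E| <= M%:E * m A)%E.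
  apply: (@le_trans _ _ (\int[m]_(x in A) `|(phi x)%:E|)%E).
    apply: le_abse_integral => //; apply/measurable_EFinP; exact: measurable_funTS.
  apply: integral_le_bound => //.
  - by apply/measurable_EFinP; exact: measurable_funTS.
  - by apply: aeW => x _; rewrite lee_fin.
rewrite /charge_integral /total_variation_charge /charge_variation/=.
apply: le_trans (lee_abs_sub _ _) _.
rewrite ge0_muleDr//; exact: leeD.
Qed.

Lemma measurable_steps n (k : nat -> R) : measurable_fun setT (steps n k).
Proof.
apply: measurable_sum => j; apply: measurable_funM => //.
have -> : (fun x : R => (node R n j <= x)%R%:R : R) = \1_(`[node R n j, +oo[).
  by apply/funext => x; rewrite indicE mem_setE in_itv/= andbT.
by apply: measurable_indic; exact: measurable_itv.
Qed.

(** The smoothed field is an admissible test function, bounded by [1 + K * (2 * e)]. As e tends to 0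
    the excess disappears, and the integrals converge because the derivatives converge off the nodes
    and are dominated by a multiple of [|w|]. *)
Lemma total_variation_charge_ge (w : BV01 R) (n : nat) (k : nat -> R) : (0 < n)%N ->
  \sum_(j < n.+1) k j = 0 -> \sum_(j < n.+1) k j * node R n j = 0 ->
  (forall x, 0 <= x -> x <= 1 -> `|kinks n k x| <= 1) ->
  (- total_variation_charge (bv_deriv w) `]0%R, 1%R[ <=
   \int[mu]_(x in `]0%R, 1%R[) (w x * steps n k x)%:E)%E.
Proof.
move=> n0 k0 k1 kle1.
have [f [M fP]] := smooth_kinks_derivative n k.
(* A null sequence subject to [4 * e i <= n%:R^-1], which the support condition in (0,1) demands. *)
pose e i : R := (4 * n%:R)^-1 / i.+1%:R.
have n0' : 0 < n%:R :> R by rewrite ltr0n.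
have e0 i : 0 < e i by rewrite divr_gt0// invr_gt0 mulr_gt0.
have en i : 4 * e i <= n%:R^-1.
  have -> : 4 * e i = n%:R^-1 / i.+1%:R by rewrite /e; field; rewrite !gt_eqF.
  by rewrite ler_pdivrMr// ler_peMr ?ler1n// invr_ge0 ltW.
have ecvg (c : R) : 0 < c -> \forall i \near \oo, 2 * e i < c.
  move=> c0; near=> i.
  have h : i.+1%:R^-1 < 2 * n%:R * c.
    near: i.
    have c0' : 0 < 2 * n%:R * c by rewrite mulr_gt0// mulr_gt0.
    exact: (near_infty_natSinv_lt (PosNum c0')).
  have -> : 2 * e i = (2 * n%:R)^-1 * i.+1%:R^-1 by rewrite /e; field; rewrite !gt_eqF.
  by rewrite mulrC ltr_pdivrMr ?mulr_gt0// mulrC.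
have mA : measurable I01 by exact: measurable_itv.
have wint := bv_integrable w.
have mw : measurable_fun I01 w by apply/measurable_EFinP; exact: measurable_int wint.
have mf i : measurable_fun setT (f (e i)).
  by apply: continuous_measurable_fun; have [_ +] := fP _ (e0 i).
have mfI i : measurable_fun I01 (f (e i)) by exact: measurable_funTS.
have msI : measurable_fun I01 (steps n k).
  by apply: measurable_funTS; exact: measurable_steps.
pose K : R := \sum_(j < n.+1) `|k j|.
have K0 : 0 <= K by apply: sumr_ge0.
set TV := total_variation_charge _ _.
have TVfin : TV \is a fin_num by exact: total_variation_charge_fin_num.
have TV0 : (0 <= TV)%E by exact: total_variation_charge_ge0.
have low i : (- ((1 + K * (2 * e i))%:E * TV) <=
    \int[mu]_(x in `]0%R, 1%R[) (w x * f (e i) x)%:E)%E.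
  have [df cf _ _] := fP _ (e0 i).
  have sm : smooth (smooth_kinks n k (e i)).
    by apply: Cn_smooth => m; exact: Cn_smooth_kinks.
  have -> : (\int[mu]_(x in `]0%R, 1%R[) (w x * f (e i) x)%:E =
      - charge_integral (bv_deriv w) `]0%R, 1%R[ (smooth_kinks n k (e i)))%E.
    have cs := smooth_kinks_supported n0 k0 k1 (e0 i) (en i).
    rewrite -(bv_derivP w sm cs).
    by apply: eq_integral => x _; rewrite derive1E (@derive_val _ _ _ _ _ _ _ (df x)).
  rewrite leeN2; apply: le_trans (lee_abs _) _; apply: charge_integral_le => //.
    by apply: continuous_measurable_fun; apply: Cn_continuous; exact: Cn_smooth_kinks.
  move=> x; have [x0|x0] := lerP x 0.
    rewrite smooth_kinks_eq0//; last by rewrite (le_trans x0 (ltW (e0 i))).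
    by rewrite normr0 addr_ge0// mulr_ge0// mulr_ge0// ltW.
  have [x1|x1] := lerP 1 x.
    rewrite smooth_kinks_eq0//; last by rewrite (_ : 1 - e i <= x) ?orbT//;
      have := e0 i; lra.
    by rewrite normr0 addr_ge0// mulr_ge0// mulr_ge0// ltW.
  have := smooth_kinks_approx n k x (e0 i).
  have := kle1 x (ltW x0) (ltW x1).
  move=> H1 H2; rewrite -[X in `|X|%R](subrK (kinks n k x)) addrC.
  apply: le_trans (ler_normD _ _) _; exact: lerD.
have [|||||_ _ lim] := @dominated_convergence _ _ _ mu I01 mA
    (fun i x => (w x * f (e i) x)%:E) (fun x => (w x * steps n k x)%:E)
    (fun x => M%:E * `|(w x)%:E|)%E.
- by move=> i; have := measurable_funM mw (mfI i); move/measurable_EFinP.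
- by have := measurable_funM mw msI; move/measurable_EFinP.
- exists (range (node R n)); split.
  + by apply: countable_measurable => //; exact: sub_countable (card_image_le _ _) _.
  + by apply: countable_lebesgue_measure0; exact: sub_countable (card_image_le _ _) _.
  move=> x /= H; apply: contrapT => xn; apply: H => _.
  apply: cvg_near_cst; near=> i.
  have [_ _ _ ->//] := fP _ (e0 i).
  suff H : forall j : 'I_n.+1, 2 * e i < `|x - node R n j|.
    by move=> j jn; have := H (Ordinal (jn : (j < n.+1)%N)).
  near: i; apply: filter_forall => j; apply: ecvg.
  rewrite normr_gt0 subr_eq0; apply/eqP => xE; apply: xn; by exists j.
- exact: (@integrableZl _ _ _ mu I01 mA M _ (integrable_abse wint)).
- apply: aeW => x i _ /=; rewrite normrM mulrC lee_fin ler_wpM2r//.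
  by have [_ _ fM _] := fP _ (e0 i); exact: fM.
apply/lee_addgt0Pr => eps eps0.
have T0 : 0 <= fine TV by exact: fine_ge0.
have KT1 : 0 < K * fine TV + 1 by rewrite ltr_wpDl// mulr_ge0.
rewrite -leeBlDr// -fin_num_oppeD//.
apply: (cvge_to_ge lim); near=> i; apply: le_trans (low i).
rewrite leeN2 -(fineK TVfin) -EFinM -EFinD lee_fin mulrDl mul1r lerD2l.
(* The excess [K * (2 * e i) * fine TV] has to stay below eps; the added 1 keeps the denominator
   positive. *)
have : 2 * e i < eps / (K * fine TV + 1).
  by near: i; apply: ecvg; rewrite divr_gt0.
rewrite ltr_pdivlMr//.
have := e0 i; set E := e i; set KT := K * fine TV => E0 H.
have -> : K * (2 * E) * fine TV = 2 * E * KT by rewrite /KT; ring.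
lra.
Unshelve. all: by end_near. Qed.

End TotalVariation.

(** * Step functions in BV *)

Section UnitInterval.
Variable R : realType.
Local Notation mu := (@lebesgue_measure R).
Local Notation I01 := (`]0, 1[%classic : set R).
Local Notation integ f := (mu.-integrable I01 (EFin \o f)).
Implicit Types f g : R -> R.

Lemma measurable_I01 : measurable I01. Proof. exact: measurable_itv. Qed.
Hint Resolve measurable_I01 : core.

Lemma integrableD_EFin f g : integ f -> integ g -> integ (fun x => f x + g x).
Proof. by move=> If Ig;
  exact: (@integrableD _ _ _ mu I01 measurable_I01 _ _ If Ig). Qed.

Lemma integrableZ_EFin (c : R) f : integ f -> integ (fun x => c * f x).
Proof. by move=> If; exact: (@integrableZl _ _ _ mu I01 measurable_I01 c _ If). Qed.

Lemma integrableB_EFin f g : integ f -> integ g -> integ (fun x => f x - g x).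
Proof. by move=> If Ig;
  exact: (@integrableB _ _ _ mu I01 measurable_I01 _ _ If Ig). Qed.

Lemma lebesgue_measure_I01 : mu I01 = 1%E.
Proof. by rewrite lebesgue_measure_itv/= lte_fin ltr01 oppr0 adde0. Qed.

Lemma integrable_bounded f (M : R) : measurable_fun setT f ->
  (forall x, `|f x| <= M) -> integ f.
Proof.
move=> mf fM; apply: measurable_bounded_integrable => //.
- by have : (mu I01 < +oo)%E by rewrite lebesgue_measure_I01 ltry.
- exact: measurable_funTS.
- by exists M; split; [exact: num_real|move=> t Mt x _ /=;
  exact: le_trans (fM x) (ltW Mt)].
Qed.

Lemma integrable_mul_bounded f g (M : R) : measurable_fun setT f ->
  (forall x, `|f x| <= M) -> integ g -> integ (fun x => f x * g x).
Proof.
move=> mf fM Ig.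
apply: (@integrableMr _ _ _ mu I01 measurable_I01 f (EFin \o g)) => //.
- exact: measurable_funTS.
- by exists M; split; [exact: num_real|move=> t Mt x _ /=;
  exact: le_trans (fM x) (ltW Mt)].
Qed.

Lemma norm_bool_le1 (b : bool) : `|b%:R : R| <= 1.
Proof. by case: b; rewrite ?normr1 ?normr0. Qed.

Lemma steps_le n (k : nat -> R) x : `|steps n k x| <= \sum_(j < n.+1) `|k j|.
Proof.
apply: le_trans (ler_norm_sum _ _ _) _; apply: ler_sum => j _.
by rewrite normrM ler_piMr// norm_bool_le1.
Qed.

Lemma integrable_steps_mul n (k : nat -> R) f :
  integ f -> integ (fun x => steps n k x * f x).
Proof.
by apply: integrable_mul_bounded; [exact: measurable_steps|exact: steps_le].
Qed.

Lemma measurable_ge (y : R) : measurable_fun setT (fun x : R => (y <= x)%R%:R : R).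
Proof.
have -> : (fun x : R => (y <= x)%R%:R : R) = \1_(`[y, +oo[).
  by apply/funext => x; rewrite indicE mem_setE in_itv/= andbT.
by apply: measurable_indic; exact: measurable_itv.
Qed.

Lemma Rintegral_steps_mul n (k : nat -> R) f : integ f ->
  \int[mu]_(x in I01) (steps n k x * f x) =
  \sum_(j < n.+1) k j * \int[mu]_(x in I01) ((node R n j <= x)%R%:R * f x).
Proof.
move=> If.
have Ib (j : nat) : integ (fun x => (node R n j <= x)%R%:R * f x).
  by apply: (@integrable_mul_bounded _ _ 1) => //; [exact: measurable_ge|move=> x;
    exact: norm_bool_le1].
transitivity (\int[mu]_(x in I01) \sum_(j < n.+1) k j * ((node R n j <= x)%R%:R * f x)).
  by apply: eq_Rintegral => x _; rewrite mulr_suml; apply: eq_bigr => j _;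
    rewrite mulrA.
(* Additivity of the integral needs integrable summands, so integrability of the partial sums is
   carried through the induction. *)
suff [_ ->] : integ (fun x => \sum_(j < n.+1) k j * ((node R n j <= x)%R%:R * f x)) /\
    \int[mu]_(x in I01) \sum_(j < n.+1) k j * ((node R n j <= x)%R%:R * f x) =
    \sum_(j < n.+1) k j * \int[mu]_(x in I01) ((node R n j <= x)%R%:R * f x) by [].
elim: n.+1 => [|m [I1 I2]].
  split.
    have -> : (fun x => \sum_(j < 0) k j * ((node R n j <= x)%R%:R * f x)) = cst 0.
      by apply/funext => x; rewrite big_ord0.
    by apply: (@integrable_bounded _ 0) => // x; rewrite normr0.
  under eq_Rintegral do rewrite big_ord0.
  by rewrite big_ord0 Rintegral_cst// mul0r.
have I3 := integrableZ_EFin (k m) (Ib m).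
split.
  have := integrableD_EFin I1 I3; congr (_.-integrable _ _).
  by apply/funext => x /=; rewrite big_ord_recr.
under eq_Rintegral do rewrite big_ord_recr/=.
by rewrite RintegralD// big_ord_recr/= I2 RintegralZl.
Qed.

(** For y > 0 the two domains differ by the null point y; for y = 0 they coincide, because the unit
    interval is open. *)
Lemma Rintegral_tail (y : R) f : 0 <= y -> y <= 1 -> integ f ->
  \int[mu]_(x in I01) ((y <= x)%R%:R * f x) = \int[mu]_(x in `]y, 1[) f x.
Proof.
move=> y0 y1 If.
transitivity (\int[mu]_(x in I01 `&` `[y, +oo[) f x).
  rewrite Rintegral_mkcondr; apply: eq_Rintegral => x _.
  by rewrite patchE mem_setE in_itv/= andbT; case: ifP => _; rewrite ?mul1r ?mul0r.
move: y0; rewrite le_eqVlt => /predU1P[<-|y0].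
  congr Rintegral; apply/seteqP; split => x /=; rewrite !in_itv/= andbT.
    by case.
  by move=> /andP[x0 x1]; split; [rewrite x0|rewrite ltW].
have -> : I01 `&` `[y, +oo[ = `[y, 1[%classic.
  apply/seteqP; split => x /=; rewrite !in_itv/= andbT.
    by move=> [/andP[_ ->] ->].
  by move=> /andP[yx ->]; rewrite andbT yx (lt_le_trans y0 yx).
rewrite -Rintegral_itv_obnd_cbnd//.
apply: integrableS If => //; apply: subset_itvr.
by rewrite bnd_simp ltW.
Qed.

Lemma Rintegral_cst_tail (y c : R) : y <= 1 ->
  \int[mu]_(x in `]y, 1[) c = c * (1 - y).
Proof.
move=> y1; rewrite Rintegral_cst//; congr (c * _).
have E : mu `]y, 1[%classic = (1 - y)%:E.
  rewrite lebesgue_measure_itv/= lte_fin; case: ltP => // y1'.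
  by congr EFin; lra.
by transitivity (fine (1 - y)%:E) => //; congr fine.
Qed.

Lemma Rintegral_derive_tail (y : R) (F f : R -> R) : y <= 1 ->
  (forall x : R, is_derive x 1 F (f x)) -> continuous f ->
  \int[mu]_(x in `]y, 1[) f x = F 1 - F y.
Proof.
rewrite le_eqVlt => /predU1P[->|y1] dF cf.
  by rewrite set_itvoo0 Rintegral_set0 subrr.
have cF : continuous F.
  by move=> x; apply/differentiable_continuous/derivable1_diffP/ex_derive.
rewrite /Rintegral -(@integral_itv_bndoo _ y 1 (EFin \o f) true false); last first.
  apply/measurable_EFinP; apply: measurable_funTS.
  exact: continuous_measurable_fun.
rewrite (@continuous_FTC2 _ f F)//.
- exact: continuous_subspaceT.
- split; first by move=> x _; exact: ex_derive.
  + by apply: cvg_at_right_filter; exact: cF.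
  + by apply: cvg_at_left_filter; exact: cF.
- by move=> x _; rewrite derive1E derive_val.
Qed.

End UnitInterval.

Section StepFunctions.
Variables (R : realType) (n : nat) (J : nat -> R).
Hypotheses (n0 : (0 < n)%N) (J0 : forall j, 0 <= J j).
Local Notation mu := (@lebesgue_measure R).
Local Notation I01 := (`]0, 1[%classic : set R).
Local Notation TR := (measurableTypeR R).

Definition jump (j : nat) : {measure set TR -> \bar R} :=
  mscale (NngNum (J0 j)) (@dirac _ TR (node R n j) R).

Lemma jumpE j (A : set TR) : jump j A = (J j * (node R n j \in A)%:R)%:E.
Proof. by rewrite /jump/= /mscale/= /dirac/= indicE -EFinM. Qed.

(* The atoms at 0 and 1 lie outside of (0,1) and play no role. *)
Definition jumps : set TR -> \bar R := msum jump n.+1.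

HB.instance Definition _ := Measure.on jumps.

Let jumps_fin : fin_num_fun jumps.
Proof.
move=> A mA; rewrite /jumps /msum; apply/sum_fin_numP => j _ _.
by rewrite jumpE.
Qed.

HB.instance Definition _ := @Measure_isFinite.Build _ _ _ jumps jumps_fin.

Definition jump_charge : signed_measure R := charge_of_finite_measure jumps.

Lemma jumpsE (A : set R) : jumps A = (\sum_(j < n.+1) J j * (node R n j \in A)%:R)%:E.
Proof.
rewrite /jumps /msum -sumEFin; apply: eq_bigr => j _.
by rewrite jumpE.
Qed.

(** Whatever Hahn decomposition was chosen, the negative part of A is minus the charge of a
    measurable set, hence at most 0 for a positive measure. *)
Lemma jordan_neg_jump_charge (A : set R) : measurable A ->
  jordan_neg (hahnP jump_charge) A = 0%E.
Proof.
move=> mA; apply/eqP; rewrite eq_le measure_ge0 andbT.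
rewrite jordan_negE cjordan_negE /crestr0 mem_set// /crestr.
by rewrite leeNl oppe0; exact: (measure_ge0 jumps).
Qed.

Lemma jordan_pos_jump_charge (A : set R) : measurable A ->
  jordan_pos (hahnP jump_charge) A = jumps A.
Proof.
move=> mA; have := jordan_decomp (hahnP jump_charge) mA.
have -> : cadd (jordan_pos (hahnP jump_charge))
    (cscale (-1) (jordan_neg (hahnP jump_charge))) A =
    (jordan_pos (hahnP jump_charge) A + (-1)%:E * jordan_neg (hahnP
      jump_charge) A)%E by [].
by rewrite jordan_neg_jump_charge// mule0 adde0 => <-.
Qed.

Lemma total_variation_jump_charge :
  total_variation_charge jump_charge `]0%R, 1%R[ = jumps I01.
Proof.
rewrite /total_variation_charge /charge_variation/=.
by rewrite jordan_pos_jump_charge// jordan_neg_jump_charge// adde0.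
Qed.

Lemma ge0_integral_jumps (A : set TR) (f : TR -> \bar R) : measurable A ->
  measurable_fun A f -> (forall x, A x -> (0 <= f x)%E) ->
  (\int[jumps]_(x in A) f x =
   \sum_(j < n.+1) (J j)%:E * ((node R n j \in A)%:R%:E * f (node R n j)))%E.
Proof.
move=> mA mf f0; rewrite ge0_integral_measure_sum//; apply: eq_bigr => j _.
by rewrite ge0_integral_mscale// integral_dirac// diracE.
Qed.

Lemma charge_integral_jump_charge (A : set TR) (phi : R -> R) : measurable A ->
  measurable_fun setT phi ->
  charge_integral jump_charge A phi =
  (\sum_(j < n.+1) J j * ((node R n j \in A)%:R * phi (node R n j)))%:E.
Proof.
move=> mA mphi; rewrite /charge_integral.
have -> : (\int[jordan_pos (hahnP jump_charge)]_(x in A) (phi x)%:E =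
    \int[jumps]_(x in A) (phi x)%:E)%E.
  by apply: eq_measure_integral => B mB _; exact: jordan_pos_jump_charge.
have -> : (\int[jordan_neg (hahnP jump_charge)]_(x in A) (phi x)%:E = 0)%E.
  rewrite (eq_measure_integral mzero) ?integral_measure_zero// => B mB _.
  exact: jordan_neg_jump_charge.
rewrite sube0 integralE.
have mphiA : measurable_fun A (fun x : TR => (phi x)%:E).
  by apply/measurable_EFinP; exact: measurable_funTS.
rewrite ge0_integral_jumps//; last exact: measurable_funepos.
rewrite ge0_integral_jumps//; last exact: measurable_funeneg.
have pos j : ((J j)%:E * ((node R n j \in A)%:R%:E * (fun x : TR => (phi
  x)%:E)^\+ (node R n j)) =
   (J j * ((node R n j \in A)%:R * Num.max (phi (node R n j)) 0))%:E)%E.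
  by rewrite funeposE -EFin_max -!EFinM.
have neg j : ((J j)%:E * ((node R n j \in A)%:R%:E * (fun x : TR => (phi
  x)%:E)^\- (node R n j)) =
   (J j * ((node R n j \in A)%:R * Num.max (- phi (node R n j)) 0))%:E)%E.
  by rewrite funenegE -EFinN -EFin_max -!EFinM.
under eq_bigr do rewrite pos; under [X in (_ - X)%E]eq_bigr do rewrite neg.
rewrite !sumEFin -EFinB -sumrB; congr EFin; apply: eq_bigr => j _.
rewrite -!mulrBr; congr (_ * (_ * _)).
by case: (lerP (phi (node R n j)) 0); case: (lerP (- phi (node R n j)) 0) => ? ?; lra.
Qed.

Lemma node_ge0 j : 0 <= node R n j.
Proof. by rewrite divr_ge0. Qed.

Lemma node_le1 j : (j <= n)%N -> node R n j <= 1.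
Proof. by move=> jn; rewrite ler_pdivrMr ?ltr0n// mul1r ler_nat. Qed.

Lemma steps_integrable : mu.-integrable `]0, 1[ (EFin \o steps n J).
Proof. by apply: integrable_bounded; [exact: measurable_steps|exact: steps_le]. Qed.

(** By linearity it suffices to treat one jump, where the integral of phi' from the node to 1 is
    minus phi at the node. Since phi vanishes off (0,1), nodes 0 and n contribute nothing on either
    side. *)
Lemma steps_derivP : distributional_derivative (steps n J) jump_charge.
Proof.
move=> phi sphi [_ supp].
have dphi (x : R) : is_derive x 1 phi (phi^`()%classic x).
  rewrite derive1E; apply: derivableP; exact: (sphi 0%N).
have cphi' : continuous phi^`()%classic.
  by move=> x; apply/differentiable_continuous/derivable1_diffP; exact: (sphi 1%N).
have cphi : continuous phi.
  by move=> x; apply/differentiable_continuous/derivable1_diffP; exact: (sphi 0%N).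
have phi0 x : ~ I01 x -> phi x = 0.
  by move=> Ix; apply: contrapT => /eqP px; apply: Ix; apply: supp;
    exact: subset_closure.
have Iphi' : mu.-integrable I01 (EFin \o phi^`()%classic).
  have : mu.-integrable `[0, 1]%classic (EFin \o phi^`()%classic).
    by apply: continuous_compact_integrable;
      [exact: segment_compact|exact: continuous_subspaceT].
  by apply: integrableS => //; exact: subset_itv_oo_cc.
have Isphi := integrable_steps_mul n J Iphi'.
transitivity ((\int[mu]_(x in I01) (steps n J x * phi^`()%classic x))%:E).
  by rewrite /Rintegral fineK//; exact: integrable_fin_num Isphi.
rewrite charge_integral_jump_charge//; last exact: continuous_measurable_fun.
rewrite Rintegral_steps_mul// -EFinN -sumrN; congr EFin; apply: eq_bigr => j _.
have j1 : node R n j <= 1 by apply: node_le1; rewrite -ltnS.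
rewrite Rintegral_tail ?node_ge0// (Rintegral_derive_tail j1 dphi cphi').
rewrite (phi0 1) ?sub0r ?mulrN; last by rewrite /= in_itv/= ltxx andbF.
congr (- (_ * _)); case: (boolP (node R n j \in I01)) => [_|/negP H];
  first by rewrite mul1r.
by rewrite phi0 ?mulr0// => H'; apply: H; rewrite inE.
Qed.

Definition stepBV : BV01 R := MkBV01 steps_integrable steps_derivP.

End StepFunctions.

(** * Dual certificates *)

Section Grid.
Variables (R : realType) (n : nat).
Hypothesis n0 : (0 < n)%N.
Local Notation nd := (node R n).
Implicit Types (f : nat -> R) (x : R).

(** Inverse to partial summation: with these coefficients [steps] takes the value [f i] on the cell
    from i / n to (i + 1) / n. *)
Definition increments f (j : nat) : R := if j is i.+1 then f i.+1 - f i else f 0%N.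

Lemma sum_increments f m : \sum_(j < m.+1) increments f j = f m.
Proof.
elim: m => [|m IH]; first by rewrite big_ord1.
by rewrite big_ord_recr/= IH addrC subrK.
Qed.

Let n0R : 0 < n%:R :> R. Proof. by rewrite ltr0n. Qed.

Lemma node_cell x : 0 <= x -> x < 1 ->
  exists2 i, (i < n)%N & (nd i <= x) && (x < nd i.+1).
Proof.
move=> x0 x1; have nx0 : 0 <= n%:R * x by rewrite mulr_ge0.
have /andP[H1 H2] := truncn_itv nx0; exists (Num.truncn (n%:R * x)).
  rewrite -(ltr_nat R); apply: le_lt_trans H1 _.
  by rewrite -[ltRHS]mulr1 ltr_pM2l.
by rewrite /node ler_pdivrMr// ltr_pdivlMr// (mulrC x) H1 H2.
Qed.

Lemma le_node i j : (nd i <= nd j) = (i <= j)%N.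
Proof. by rewrite /node ler_pM2r ?invr_gt0// ler_nat. Qed.

Lemma node_in_I01 j : (nd j \in (`]0, 1[%classic : set R)) = (0 < j < n)%N.
Proof.
rewrite mem_setE in_itv/= /node ltr_pdivrMr// mul1r ltr_nat.
by rewrite pmulr_lgt0 ?invr_gt0// ltr0n.
Qed.

Lemma node_le_cell i j x : nd i <= x -> x < nd i.+1 -> (nd j <= x) = (j <= i)%N.
Proof.
move=> ix xi; apply/idP/idP => [jx|ji].
  by rewrite -ltnS ltnNge; apply/negP => ij; have := le_node i.+1 j; rewrite ij; lra.
by apply: le_trans ix; rewrite le_node.
Qed.

Lemma steps_cell f i x : (i <= n)%N -> nd i <= x -> x < nd i.+1 ->
  steps n (increments f) x = f i.
Proof.
move=> leni ix xi; rewrite -sum_increments (big_ord_widen n.+1)// [RHS]big_mkcond/=.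
apply: eq_bigr => j _; rewrite (node_le_cell _ ix xi) ltnS.
by case: ifP; rewrite ?mulr1 ?mulr0.
Qed.

(** Cells are counted from 0 here but from 1 in [staircase], whence the value with [i.+1]. *)
Lemma staircase_cell i x : (i < n)%N -> nd i <= x -> x < nd i.+1 ->
  staircase n x = i.+1%:R / n%:R.
Proof.
move=> leni ix xi; rewrite /staircase big_add1/= big_mkord.
rewrite (bigD1 (Ordinal leni))//= big1 => [|j /eqP ji].
  by rewrite addr0 indicE mem_set ?mulr1//= in_itv/= ix.
rewrite indicE memNset ?mulr0//= in_itv/= => /andP[jx xj].
apply: ji; apply/val_inj/eqP => /=; rewrite eqn_leq -(node_le_cell _ ix xi) jx.
by rewrite -(node_le_cell _ jx xj).
Qed.

(** Each summand has its only kink at a node, so it is affine on the cell and equals the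
    interpolation of its end values. *)
Lemma kinks_cell (k : nat -> R) i x : nd i <= x -> x <= nd i.+1 ->
  kinks n k x = (1 - (n%:R * x - i%:R)) * kinks n k (nd i) +
                (n%:R * x - i%:R) * kinks n k (nd i.+1).
Proof.
move=> ix xi; rewrite /kinks !mulr_sumr -big_split/=; apply: eq_bigr => j _.
have xE : x = (n%:R * x) / n%:R by rewrite mulrAC divff ?gt_eqF// mul1r.
have [ji|ij] := leqP j i.
  have jile : nd j <= nd i by rewrite le_node.
  have ile : nd i <= nd i.+1 by rewrite le_node.
  rewrite !max_r; try lra.
  rewrite /node -[i.+1%:R]natr1 {1}xE; field; by rewrite gt_eqF.
have jile : nd i.+1 <= nd j by rewrite le_node.
have ile : nd i <= nd i.+1 by rewrite le_node.
by rewrite !max_l ?mulr0 ?addr0//; lra.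
Qed.

(** A slope n (f (i + 1) - f i) over a cell of length 1 / n restores the increment of f. This is how
    a dual field is prescribed by its nodal values. *)
Lemma kinks_node f i : (i <= n)%N ->
  kinks n (increments (fun j => n%:R * (f j.+1 - f j))) (nd i) = f i - f 0%N.
Proof.
set k := increments _; elim: i => [_|i IH leni].
  rewrite subrr /kinks big1// => j _; rewrite max_l ?mulr0//.
  by rewrite {1}/node mul0r sub0r oppr_le0 node_ge0.
have H : kinks n k (nd i.+1) = kinks n k (nd i) + n%:R^-1 * steps n k (nd i).
  rewrite /kinks /steps mulr_sumr -big_split/=; apply: eq_bigr => j _.
  rewrite le_node; have [ji|ij] := leqP j i.
    have jile : nd j <= nd i by rewrite le_node.
    have ile : nd i <= nd i.+1 by rewrite le_node.
    rewrite !max_r; try lra.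
    rewrite /node -[i.+1%:R]natr1/=; field; by rewrite gt_eqF.
  have jile : nd i.+1 <= nd j by rewrite le_node.
  have ile : nd i <= nd i.+1 by rewrite le_node.
  by rewrite !max_l/= ?mulr0 ?addr0//; lra.
rewrite H (IH (ltnW leni)) (@steps_cell _ i) ?(ltnW leni)//; last first.
  by rewrite ltNge le_node ltnn.
by field; rewrite gt_eqF.
Qed.

End Grid.

Section Certificate.
Variables (R : realType) (lambda : R) (n : nat) (U Z : nat -> R).
Hypotheses (lambda0 : 0 < lambda) (n0 : (0 < n)%N).
(* [U i] is the value of the minimizer u on the cell `[i / n, (i + 1) / n[ and
   [Z i] the value at i / n of the dual field z, such that
   z' = 2 lambda (u - g) and z = 1 at the jumps of u. *)
Hypotheses (Z_start : Z 0%N = 0) (Z_end : forall j, (n <= j)%N -> Z j = 0).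
Hypothesis Z_bound : forall j, 0 <= Z j <= 1.
Hypothesis Z_incr : forall i, (i < n)%N ->
  n%:R * (Z i.+1 - Z i) = 2 * lambda * (U i - i.+1%:R / n%:R).
Hypotheses (U_ge0 : 0 <= U 0%N) (U_nondecreasing : forall i, U i <= U i.+1).
Hypothesis U_jump : forall i, (i.+1 < n)%N -> U i.+1 = U i \/ Z i.+1 = 1.
Local Notation mu := (@lebesgue_measure R).
Local Notation I01 := (`]0, 1[%classic : set R).
Local Notation nd := (node R n).

(** In terms of the dual field z, [kinks n kappa] is z and [steps n kappa] is z'. [G] agrees with
    the staircase on (0,1) and has the form that the lemmas on [steps] require. *)
Let J := increments U.
Let kappa := increments (fun j => n%:R * (Z j.+1 - Z j)).
Let G : R -> R := steps n (increments (fun i => i.+1%:R / n%:R)).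
Let g := @staircase R n.

Lemma jump_ge0 j : 0 <= J j.
Proof. by case: j => [|j]/=; rewrite /J/= ?subr_ge0. Qed.

Definition step_minimizer : BV01 R := stepBV n0 jump_ge0.
Let u := step_minimizer.

Lemma step_minimizer_cell i x : (i < n)%N -> nd i <= x -> x < nd i.+1 -> u x = U i.
Proof. by move=> leni ix xi; exact: (steps_cell n0 U (ltnW leni)). Qed.

Let n0R : 0 < n%:R :> R. Proof. by rewrite ltr0n. Qed.

(** The sum telescopes to the slope beyond node n, which is zero because Z vanishes at n + 1 as well
    as at n. *)
Lemma dual_sum : \sum_(j < n.+1) kappa j = 0.
Proof. by rewrite sum_increments !Z_end// subrr mulr0. Qed.

Lemma dual_node i : (i <= n)%N -> kinks n kappa (nd i) = Z i.
Proof. by move=> leni; rewrite kinks_node// Z_start subr0. Qed.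

(** Evaluating z at 1 gives the sum of [kappa j * (1 - nd j)], which is [Z n = 0]; [dual_sum]
    removes the first half. *)
Lemma dual_moment : \sum_(j < n.+1) kappa j * nd j = 0.
Proof.
have nodeT : nd n = 1 by rewrite /node divff// gt_eqF.
have := dual_node (leqnn n); rewrite Z_end// nodeT => H.
have : \sum_(j < n.+1) kappa j * (1 - nd j) = 0.
  rewrite -[RHS]H; apply: eq_bigr => j _; rewrite max_r// subr_ge0.
  by rewrite node_le1// -ltnS.
under eq_bigr do rewrite mulrBr mulr1.
by rewrite sumrB dual_sum sub0r => /eqP; rewrite oppr_eq0 => /eqP.
Qed.

(** On each cell z is a convex combination of two nodal values in [0, 1]. *)
Lemma dual_bound x : 0 <= x -> x <= 1 -> `|kinks n kappa x| <= 1.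
Proof.
move=> x0; rewrite le_eqVlt => /predU1P[->|x1].
  have <- : nd n = 1 by rewrite /node divff// gt_eqF.
  by rewrite dual_node// Z_end// normr0 node_ge0.
have [i leni /andP[ix xi]] := node_cell n0 x0 x1.
rewrite (kinks_cell n0 _ ix (ltW xi)) !dual_node//; last exact: ltnW.
move: ix xi; rewrite /node ler_pdivrMr// ltr_pdivlMr// -natr1.
have /andP[? ?] := Z_bound i; have /andP[? ?] := Z_bound i.+1.
by move=> ix xi; rewrite ler_norml; apply/andP; split; nra.
Qed.

Lemma in_cell x : I01 x -> exists2 i, (i < n)%N & nd i <= x /\ x < nd i.+1.
Proof.
rewrite /= in_itv/= => /andP[x0 x1].
have [i leni /andP[ix xi]] := node_cell n0 (ltW x0) x1.
by exists i.
Qed.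

Lemma staircase_steps x : I01 x -> g x = G x.
Proof.
move=> /in_cell[i leni [ix xi]].
by rewrite /g /G (staircase_cell n0 leni)// (steps_cell n0 _ (ltnW leni)).
Qed.

Lemma dual_steps x : I01 x -> steps n kappa x = 2 * lambda * (u x - G x).
Proof.
move=> /in_cell[i leni [ix xi]].
rewrite (steps_cell n0 _ (ltnW leni))// (step_minimizer_cell leni)//.
by rewrite /G (steps_cell n0 _ (ltnW leni))// Z_incr.
Qed.

(** The fundamental theorem of calculus for z with z(1) = 0, computed kink by kink since z is not
    differentiable at the nodes. *)
Lemma dual_tail y : 0 <= y -> y <= 1 ->
  \int[mu]_(x in I01) ((y <= x)%R%:R * steps n kappa x) = - kinks n kappa y.
Proof.
move=> y0 y1.
have Iy : mu.-integrable I01 (EFin \o (fun x : R => (y <= x)%R%:R : R)).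
  by apply: (@integrable_bounded _ _ 1); [exact: measurable_ge|move=> x;
    exact: norm_bool_le1].
have I1 : mu.-integrable I01 (EFin \o (fun x : R => 1 : R)).
  by apply: (@integrable_bounded _ _ 1) => // x; rewrite normr1.
transitivity (\int[mu]_(x in I01) (steps n kappa x * (y <= x)%R%:R)).
  by apply: eq_Rintegral => x _; rewrite mulrC.
rewrite Rintegral_steps_mul//.
have E (j : 'I_n.+1) : \int[mu]_(x in I01) ((nd j <= x)%R%:R * (y <= x)%R%:R) =
    1 - nd j - Num.max 0 (y - nd j).
  have j1 : nd j <= 1 by rewrite node_le1// -ltnS.
  have j0 := node_ge0 R n j.
  transitivity (\int[mu]_(x in I01) ((Num.max (nd j) y <= x)%R%:R * 1)).
    apply: eq_Rintegral => x _; rewrite mulr1 ge_max.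
    by case: (nd j <= x); case: (y <= x); rewrite ?mulr0 ?mulr1.
  rewrite Rintegral_tail//; last 2 first.
  - by rewrite le_max y0 orbT.
  - by rewrite ge_max j1 y1.
  rewrite Rintegral_cst_tail; last by rewrite ge_max j1 y1.
  by rewrite mul1r; case: (lerP (nd j) y) => ?; case: (lerP 0 (y - nd j)) => ?; lra.
under eq_bigr do rewrite E mulrBr mulrBr mulr1.
by rewrite !sumrB dual_sum dual_moment subr0 sub0r.
Qed.

(** Summation by parts turns the right-hand side into the sum of [J j * Z j]. At an interior node
    either the jump is 0 or Z is 1; at nodes 0 and n, outside (0,1), Z is 0. *)
Lemma dual_tv : total_variation_charge (bv_deriv u) `]0%R, 1%R[ =
  (- \int[mu]_(x in I01) (steps n kappa x * u x))%:E.
Proof.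
rewrite total_variation_jump_charge jumpsE; congr EFin.
have Ik : mu.-integrable I01 (EFin \o steps n kappa).
  by apply: integrable_bounded; [exact: measurable_steps|exact: steps_le].
have -> : \int[mu]_(x in I01) (steps n kappa x * u x) =
    \int[mu]_(x in I01) (steps n J x * steps n kappa x).
  by apply: eq_Rintegral => x _; rewrite mulrC.
rewrite Rintegral_steps_mul// -sumrN; apply: eq_bigr => j _.
have jn : (j <= n)%N by rewrite -ltnS.
rewrite dual_tail ?node_ge0 ?node_le1// dual_node// mulrN opprK node_in_I01//.
case: j jn => -[|j] jn' jn /=; first by rewrite Z_start.
have [jn1|nj] := ltnP; last by rewrite Z_end.
by rewrite /J/=; case: (U_jump jn1) => ->; rewrite ?subrr ?mul0r.
Qed.

Lemma measurable_bv (w : BV01 R) : measurable_fun I01 w.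
Proof. by apply/measurable_EFinP; exact: measurable_int (bv_integrable w). Qed.

Let integrable_sqr_uG : mu.-integrable I01 (EFin \o (fun x => (u x - G x) ^+ 2)).
Proof.
have -> : (fun x => (u x - G x) ^+ 2) = (fun x => u x * (u x - G x) - G x * (u
  x - G x)).
  by apply/funext => x; ring.
have IuG : mu.-integrable I01 (EFin \o (fun x => u x - G x)).
  apply: integrableB_EFin; first exact: bv_integrable.
  by apply: integrable_bounded; [exact: measurable_steps|exact: steps_le].
by apply: integrableB_EFin; exact: integrable_steps_mul.
Qed.

Lemma ROF_eq (w : BV01 R) : ROF lambda g w =
  (total_variation_charge (bv_deriv w) `]0%R, 1%R[ +
   lambda%:E * \int[mu]_(x in I01) ((w x - G x) ^+ 2)%:E)%E.
Proof.
rewrite /ROF; congr (_ + _ * _)%E; apply: eq_integral => x; rewrite inE => Ix.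
by rewrite staircase_steps.
Qed.

(* Integrating z against the derivative of w gives |w'| >= - \int z' w, with
   equality for w = u; the rest of the functional is an exact square. *)
Lemma ROF_quadratic_growth (w : BV01 R) :
  (ROF lambda g u + lambda%:E * \int[mu]_(x in I01) ((w x - u x) ^+ 2)%:E <=
   ROF lambda g w)%E.
Proof.
(* The closing computation: A and B are lambda times the squared distances of w and u to g, P and Q
   the integrals of z' w and z' u, and T the total variation of w. *)
have arith (A B P Q T : R) : - T <= P -> - Q + B + (A - B - (P - Q)) <= T + A by lra.
rewrite !ROF_eq.
have sqr_ge0E (h : R -> R) : (0 <= \int[mu]_(x in I01) ((h x) ^+ 2)%:E)%E.
  by apply: integral_ge0 => x _; rewrite lee_fin sqr_ge0.
(* A function of [BV01] is only known to be integrable, so the fidelity term may be infinite; the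
   inequality is then trivial. *)
have [->|] := eqVneq (\int[mu]_(x in I01) ((w x - G x) ^+ 2)%:E)%E +oo%E.
  rewrite gt0_muley ?lte_fin// addey ?leey//.
  by rewrite -ltNye (lt_le_trans _ (total_variation_charge_ge0 _ _))// ltNy0.
rewrite -ltey => wGlt.
have mG : measurable_fun I01 G by apply: measurable_funTS; exact: measurable_steps.
have IwG : mu.-integrable I01 (EFin \o (fun x => (w x - G x) ^+ 2)).
  apply/integrableP; split.
    have := measurable_funX 2 (measurable_funB (measurable_bv w) mG).
    by move/measurable_EFinP.
  rewrite (_ : (\int[mu]_(x in I01) `|(EFin \o (fun x => (w x - G x) ^+ 2)%R) x|)%E =
     (\int[mu]_(x in I01) ((w x - G x) ^+ 2)%:E)%E)//.
  by apply: eq_integral => x _ /=; rewrite ger0_norm// sqr_ge0.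
have Iwu : mu.-integrable I01 (EFin \o (fun x => w x - u x)).
  by apply: integrableB_EFin; exact: bv_integrable.
have Ik (v : BV01 R) : mu.-integrable I01 (EFin \o (fun x => steps n kappa x * v x)).
  by apply: integrable_steps_mul; exact: bv_integrable.
(* The cross term of the square; multiplied by lambda it is z' (w - u). *)
pose C x := 2 * ((u x - G x) * (w x - u x)).
have IC : mu.-integrable I01 (EFin \o C).
  apply: integrableZ_EFin.
  rewrite (_ : (fun x => _) = (fun x => u x * (w x - u x) - G x * (w x - u x))).
    by apply: integrableB_EFin; exact: integrable_steps_mul.
  by apply/funext => x; rewrite mulrBl.
have DE : (fun x => (w x - u x) ^+ 2) =
    (fun x => (w x - G x) ^+ 2 - (u x - G x) ^+ 2 - C x).
  by apply/funext => x; rewrite /C; ring.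
have I2 := integrableB_EFin IwG integrable_sqr_uG.
have ID := integrableB_EFin I2 IC.
have Rint f : mu.-integrable I01 (EFin \o f) ->
    (\int[mu]_(x in I01) (f x)%:E)%E = (\int[mu]_(x in I01) f x)%:E.
  by move=> If; rewrite /Rintegral fineK//; exact: integrable_fin_num If.
have IDwu : mu.-integrable I01 (EFin \o (fun x => (w x - u x) ^+ 2)) by rewrite DE.
rewrite (Rint _ IwG) (Rint _ integrable_sqr_uG) (Rint _ IDwu).
have -> : \int[mu]_(x in I01) ((w x - u x) ^+ 2) =
   \int[mu]_(x in I01) ((w x - G x) ^+ 2) - \int[mu]_(x in I01) ((u x - G x) ^+ 2)
   - \int[mu]_(x in I01) C x.
  rewrite DE RintegralB//.
  by rewrite RintegralB//.
have CE : lambda * \int[mu]_(x in I01) C x =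
   \int[mu]_(x in I01) (steps n kappa x * w x) - \int[mu]_(x in I01) (steps n
     kappa x * u x).
  rewrite -RintegralB//.
  rewrite -RintegralZl//.
  apply: eq_Rintegral => x; rewrite inE => Ix.
  by rewrite dual_steps// /C; ring.
have := total_variation_charge_ge w n0 dual_sum dual_moment dual_bound.
have -> : (\int[mu]_(x in `]0%R, 1%R[) (w x * steps n kappa x)%:E)%E =
    (\int[mu]_(x in I01) (steps n kappa x * w x))%:E.
  by rewrite -(Rint _ (Ik w)); apply: eq_integral => x _; rewrite mulrC.
rewrite dual_tv.
have /fineK <- : total_variation_charge (bv_deriv w) `]0%R, 1%R[ \is a fin_num.
  by apply: total_variation_charge_fin_num; exact: measurable_I01.
rewrite -EFinN -!EFinM -!EFinD !lee_fin.
by move=> le; rewrite !mulrBr CE; move: le; exact: arith.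
Qed.

Lemma ROF_step_minimizer_fin : ROF lambda g u \is a fin_num.
Proof.
rewrite ROF_eq dual_tv fin_numD/= fin_numM//.
exact: integrable_fin_num integrable_sqr_uG.
Qed.

Lemma step_minimizerP : ROF_minimizer lambda g u.
Proof.
move=> w; apply: le_trans (ROF_quadratic_growth w).
rewrite leeDl//; apply: mule_ge0; first by rewrite lee_fin ltW.
by apply: integral_ge0 => x _; rewrite lee_fin sqr_ge0.
Qed.

(** Quadratic growth leaves no room for a positive squared distance between v and u, once the finite
    value at u is cancelled. *)
Lemma step_minimizer_unique (v : BV01 R) : ROF_minimizer lambda g v -> bv_eq v u.
Proof.
move=> /(_ u) vu; have := le_trans (ROF_quadratic_growth v) vu.
rewrite -{2}[ROF lambda g u]adde0 leeD2lE ?ROF_step_minimizer_fin//.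
rewrite pmule_rle0 ?lte_fin// => le0.
have mvu : measurable_fun I01 (fun x => ((v x - u x) ^+ 2)).
  by apply: measurable_funX; apply: measurable_funB; exact: measurable_bv.
have eq0 : (\int[mu]_(x in I01) `|((v x - u x) ^+ 2)%:E| = 0)%E.
  apply/eqP; rewrite eq_le integral_ge0 ?andbT// (le_trans _ le0)//.
  rewrite le_eqVlt; apply/orP; left; apply/eqP.
  by apply: eq_integral => x _ /=; rewrite ger0_norm// sqr_ge0.
have [+ _] := @ae_eq_integral_abs _ _ _ mu I01 (@measurable_I01 R) _
  ((measurable_EFinP _ _).2 mvu).
move=> /(_ eq0); apply: filterS => x /= H x0 x1.
have /H : `]0, 1[%classic x by rewrite /= in_itv/= x0 x1.
by case=> /eqP; rewrite sqrf_eq0 subr_eq0 => /eqP.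
Qed.

End Certificate.

(** * The explicit minimizers *)

Section Explicit.
Variables (R : realType) (lambda : R) (n : nat).
Hypotheses (lambda_gt1 : 1 < lambda) (n0 : (0 < n)%N).
Local Notation nd := (node R n).

Let lambda0 : 0 < lambda. Proof. exact: lt_trans lambda_gt1. Qed.
Let lambda_ge0 : 0 <= lambda. Proof. exact: ltW. Qed.
Let n0R : 0 < n%:R :> R. Proof. by rewrite ltr0n. Qed.

Section Constant.
Hypothesis small : forall j, lambda * (j%:R * (n - j)%:R) <= n%:R ^+ 2.

Definition mean_value (i : nat) : R := (n%:R + 1) / (2 * n%:R).

(** The parabola solving the difference equation of the dual field with zero ends; [small] says that
    it stays below 1. Truncated subtraction makes it vanish beyond n too. *)
Definition mean_dual (j : nat) : R := lambda * (j%:R * (n - j)%:R) / n%:R ^+ 2.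

Lemma mean_dual_start : mean_dual 0 = 0.
Proof. by rewrite /mean_dual mul0r mulr0 mul0r. Qed.

Lemma mean_dual_end j : (n <= j)%N -> mean_dual j = 0.
Proof. by move=> /eqP nj; rewrite /mean_dual nj !mulr0 mul0r. Qed.

Lemma mean_dual_bound j : 0 <= mean_dual j <= 1.
Proof.
apply/andP; split; first by rewrite divr_ge0 ?mulr_ge0 ?sqr_ge0.
by rewrite ler_pdivrMr ?exprn_gt0// mul1r; exact: small.
Qed.

Lemma mean_dual_incr i : (i < n)%N ->
  n%:R * (mean_dual i.+1 - mean_dual i) =
  2 * lambda * (mean_value i - i.+1%:R / n%:R).
Proof.
move=> leni; rewrite /mean_dual /mean_value !natrB//; last exact: ltnW.
by rewrite -natr1; field; rewrite gt_eqF.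
Qed.

Lemma mean_value_ge0 i : 0 <= mean_value i.
Proof. by rewrite divr_ge0 ?addr_ge0 ?mulr_ge0. Qed.

Lemma mean_minimizer : exists u : BV01 R, ROF_minimizer lambda (staircase n) u /\
  forall v : BV01 R, ROF_minimizer lambda (staircase n) v -> bv_eq v u.
Proof.
pose H := step_minimizerP lambda0 n0 mean_dual_start mean_dual_end
  mean_dual_bound mean_dual_incr (mean_value_ge0 0) (fun=> lexx _)
  (fun _ _ => or_introl erefl).
pose H' := @step_minimizer_unique _ _ _ _ _ lambda0 n0 mean_dual_start mean_dual_end
  mean_dual_bound mean_dual_incr (mean_value_ge0 0) (fun=> lexx _)
  (fun _ _ => or_introl erefl).
by exists (step_minimizer n0 (mean_value_ge0 0) (fun=> lexx _)).
Qed.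

End Constant.

Section Clipped.
Variable k : nat.
Hypotheses (k0 : (0 < k)%N) (k2 : (k + k <= n)%N).
Hypothesis kn : lambda * (k%:R * (k%:R - 1)) <= n%:R ^+ 2.
Hypothesis nk : n%:R ^+ 2 <= lambda * (k%:R * (k%:R + 1)).
Hypothesis nk' : n%:R ^+ 2 <= lambda * (k%:R * (n%:R - k%:R)).

Let k0R : 0 < k%:R :> R. Proof. by rewrite ltr0n. Qed.

(* Equating the dual field to 1 at k / n, that is,
   2 lambda \int_0^(k/n) (clip_level - g) = 1. *)
Definition clip_level : R := (k%:R + 1) / (2 * n%:R) + n%:R / (2 * lambda * k%:R).
Local Notation alpha := clip_level.

(** Since [clip_level] lies between k / n and (k + 1) / n, truncation raises exactly the first k
    cells and, by symmetry, lowers the last k. *)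
Definition clipped (i : nat) : R :=
  if (i < k)%N then alpha
  else if (i < n - k)%N then i.+1%:R / n%:R else 1 + n%:R^-1 - alpha.

(** The quadratic through (0, 0) and (k, 1) whose second difference is - 2 lambda / n^2, as the
    slope 1 of the staircase dictates. *)
Definition half_dual (j : nat) : R :=
  lambda / n%:R ^+ 2 * (j%:R * (k%:R - j%:R)) + j%:R / k%:R.

Definition clip_dual (j : nat) : R :=
  if (j <= k)%N then half_dual j
  else if (j <= n - k)%N then 1 else half_dual (n - j).

Let kleSk : (k <= n - k)%N. Proof.
by rewrite leq_subRL// (leq_trans _ k2)// leq_addr. Qed.
Let klen : (k <= n)%N. Proof. exact: leq_trans kleSk (leq_subr _ _). Qed.

Lemma half_dual_k : half_dual k = 1.
Proof. by rewrite /half_dual subrr !mulr0 add0r divff// gt_eqF. Qed.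

(** The distance to 1 factors through k - j and n^2 - lambda k j. For integers j < k the second
    factor is nonnegative by [kn]. *)
Lemma half_dual_bound j : (j <= k)%N -> 0 <= half_dual j <= 1.
Proof.
move=> jk; have jkR : j%:R <= k%:R :> R by rewrite ler_nat.
apply/andP; split.
  by rewrite addr_ge0 ?mulr_ge0 ?divr_ge0 ?sqr_ge0 ?subr_ge0.
move: jk; rewrite leq_eqVlt => /predU1P[->|jk]; first by rewrite half_dual_k.
have jkR' : j%:R <= k%:R - 1 :> R by rewrite lerBrDr natr1 ler_nat.
have j0 : 0 <= j%:R :> R by [].
have H : lambda * (k%:R * j%:R) <= n%:R ^+ 2.
  by apply: le_trans kn; rewrite ler_pM2l// ler_pM2l.
have -> : half_dual j =
    1 - (k%:R - j%:R) * (n%:R ^+ 2 - lambda * (k%:R * j%:R)) / (k%:R * n%:R ^+ 2).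
  by rewrite /half_dual; field; rewrite !gt_eqF.
by rewrite gerBl divr_ge0 ?mulr_ge0 ?sqr_ge0 ?subr_ge0.
Qed.

Lemma clip_dual_mid j : (k <= j)%N -> (j <= n - k)%N -> clip_dual j = 1.
Proof.
move=> kj jnk; rewrite /clip_dual jnk; case: ifP => // jk.
by have -> : j = k by [apply/eqP; rewrite eqn_leq jk]; exact: half_dual_k.
Qed.

Lemma clip_dual_right j : (n - k <= j)%N -> clip_dual j = half_dual (n - j).
Proof.
rewrite leq_eqVlt => /predU1P[<-|nkj].
  by rewrite clip_dual_mid// subKn// half_dual_k.
by rewrite /clip_dual leqNgt (leq_ltn_trans kleSk nkj)/= leqNgt nkj.
Qed.

Lemma half_dual_incr i :
  n%:R * (half_dual i.+1 - half_dual i) = 2 * lambda * (alpha - i.+1%:R / n%:R).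
Proof.
by rewrite /half_dual /clip_level -natr1; field; rewrite !gt_eqF.
Qed.

Lemma clip_dual_start : clip_dual 0 = 0.
Proof. by rewrite /clip_dual/= /half_dual !mul0r mulr0 addr0. Qed.

Lemma clip_dual_end j : (n <= j)%N -> clip_dual j = 0.
Proof.
move=> nj; rewrite clip_dual_right; last exact: leq_trans (leq_subr _ _) nj.
by move: nj => /eqP ->; rewrite /half_dual !mul0r mulr0 addr0.
Qed.

Lemma clip_dual_bound j : 0 <= clip_dual j <= 1.
Proof.
rewrite /clip_dual; case: ifPn => [/half_dual_bound//|_].
case: ifPn => [_|]; first by rewrite ler01 lexx.
rewrite -ltnNge => nkj; apply: half_dual_bound.
by rewrite leq_subLR addnC -leq_subLR ltnW.
Qed.

(** On the last k cells the reflection of j to n - j reverses the increments and exchanges the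
    levels alpha and 1 + 1 / n - alpha. *)
Lemma clip_dual_incr i : (i < n)%N ->
  n%:R * (clip_dual i.+1 - clip_dual i) = 2 * lambda * (clipped i - i.+1%:R / n%:R).
Proof.
move=> leni; rewrite /clipped; case: ifPn => [ik|]; last rewrite -leqNgt => ki.
  by rewrite /clip_dual ik (ltnW ik) half_dual_incr.
case: ifPn => [ink|]; last rewrite -leqNgt => nki.
  rewrite !clip_dual_mid//; [|exact: ltnW|exact: leqW].
  by rewrite !subrr !mulr0.
rewrite !clip_dual_right//; last exact: leqW.
have E := half_dual_incr (n - i.+1).
rewrite subnSK// in E; rewrite -opprB mulrN E natrB; last exact: ltnW.
by rewrite -natr1; field; rewrite gt_eqF.
Qed.

Lemma clip_level_ge0 : 0 <= alpha.
Proof. by rewrite addr_ge0// divr_ge0 ?addr_ge0 ?mulr_ge0. Qed.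

Lemma clipped_ge0 : 0 <= clipped 0.
Proof. by rewrite /clipped k0 clip_level_ge0. Qed.

Lemma clip_level_le : alpha <= k.+1%:R / n%:R.
Proof.
have -> : k.+1%:R / n%:R = alpha +
    (lambda * (k%:R * (k%:R + 1)) - n%:R ^+ 2) / (2 * n%:R * lambda * k%:R).
  by rewrite -natr1 /clip_level; field; rewrite !gt_eqF.
by rewrite lerDl divr_ge0 ?subr_ge0 ?mulr_ge0.
Qed.

Lemma clip_level_le_mean : 2 * alpha <= 1 + n%:R^-1.
Proof.
have -> : 1 + n%:R^-1 = 2 * alpha +
    (lambda * (k%:R * (n%:R - k%:R)) - n%:R ^+ 2) / (n%:R * lambda * k%:R).
  by rewrite /clip_level; field; rewrite !gt_eqF.
by rewrite lerDl divr_ge0 ?subr_ge0 ?mulr_ge0.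
Qed.

(** Only the junctions matter: [clip_level_le] handles both when there are middle cells, and
    [clip_level_le_mean] compares the two levels directly when n = 2 k. *)
Lemma clipped_nondecreasing i : clipped i <= clipped i.+1.
Proof.
have H1 := clip_level_le; have H2 := clip_level_le_mean.
have mono p q : (p <= q)%N -> p%:R / n%:R <= q%:R / n%:R :> R.
  by move=> pq; rewrite ler_pM2r ?invr_gt0// ler_nat.
have nkE : (n - k)%:R / n%:R = 1 + n%:R^-1 - k.+1%:R / n%:R :> R.
  by rewrite natrB// -natr1; field; rewrite gt_eqF.
rewrite /clipped; case: (ltnP i k) => ik.
  case: (ltnP i.+1 k) => Sik; first exact: lexx.
  have iE : i.+1 = k by apply/eqP; rewrite eqn_leq ik Sik.
  case: (ltnP i.+1 (n - k)) => _; last by lra.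
  by rewrite iE.
rewrite (_ : (i.+1 < k)%N = false); last by rewrite ltnNge leqW.
case: (ltnP i (n - k)) => ink.
  case: (ltnP i.+1 (n - k)) => Sink; first exact: mono.
  have -> : i.+1 = (n - k)%N by apply/eqP; rewrite eqn_leq ink Sink.
  by rewrite nkE; lra.
by rewrite ltnNge leqW.
Qed.

Lemma clipped_jump i : (i.+1 < n)%N -> clipped i.+1 = clipped i \/ clip_dual i.+1 = 1.
Proof.
move=> leni; case: (ltnP i.+1 k) => [ik|ki].
  by left; rewrite /clipped ik ltnW.
case: (leqP i.+1 (n - k)) => [ink|nki]; first by right; exact: clip_dual_mid.
left; rewrite ltnS in nki; have ki' := leq_trans kleSk nki.
by rewrite /clipped !(ltnNge i.+1) (leqW ki') (leqW nki) !(ltnNge i) ki' nki.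
Qed.

Lemma clipped_minimizer : exists u : BV01 R,
  [/\ ROF_minimizer lambda (staircase n) u,
      forall v : BV01 R, ROF_minimizer lambda (staircase n) v -> bv_eq v u &
      forall i x, (i < n)%N -> nd i <= x -> x < nd i.+1 -> u x = clipped i].
Proof.
exists (step_minimizer n0 clipped_ge0 clipped_nondecreasing); split.
- exact: (step_minimizerP lambda0 n0 clip_dual_start clip_dual_end
    clip_dual_bound clip_dual_incr _ _ clipped_jump).
- exact: (step_minimizer_unique lambda0 n0 clip_dual_start clip_dual_end
    clip_dual_bound clip_dual_incr _ _ clipped_jump).
- exact: step_minimizer_cell.
Qed.

End Clipped.
End Explicit.

(** * Existence and asymptotics of the truncation index *)

Section Threshold.
Variable R : realType.
Implicit Types (lambda : R) (n k j : nat).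

(* Equivalent to k / n <= clip_level <= (k + 1) / n. *)
Definition threshold lambda n k := [/\ (0 < k)%N,
  lambda * (k%:R * (k%:R - 1)) <= n%:R ^+ 2 &
  n%:R ^+ 2 <= lambda * (k%:R * (k%:R + 1))].

(** Take the least k satisfying the upper inequality, which n satisfies because lambda > 1. Its
    failure at k - 1 is the lower inequality. *)
Lemma threshold_exists lambda n : 1 < lambda -> (0 < n)%N ->
  exists k, threshold lambda n k.
Proof.
move=> l1 n0.
pose P k := (0 < k)%N && (n%:R ^+ 2 <= lambda * (k%:R * (k%:R + 1))).
have exP : exists k, P k.
  exists n; rewrite /P n0/=.
  have n0R : 0 < n%:R :> R by rewrite ltr0n.
  by nra.
case: (ex_minnP exP) => k /andP[k0 nk] kmin; exists k; split=> //.
case: k k0 nk kmin => // -[|k] _ nk kmin.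
  by rewrite subrr !mulr0 sqr_ge0.
have := contraNN (kmin k.+1); rewrite -ltnNge ltnSn => /(_ isT).
have -> : k.+2%:R * (k.+2%:R - 1) = k.+1%:R * (k.+1%:R + 1) :> R.
  by rewrite -[k.+2%:R]natr1; ring.
by rewrite /P/= -ltNge => /ltW.
Qed.

(** If the threshold index fails the hypotheses of [clipped_minimizer], then that of
    [mean_minimizer] holds, so one of the two constructions always applies. *)
Lemma threshold_sum_le lambda n k : 0 < lambda -> threshold lambda n k ->
  ~~ ((k + k <= n)%N && (n%:R ^+ 2 <= lambda * (k%:R * (n%:R - k%:R)))) ->
  forall j, lambda * (j%:R * (n - j)%:R) <= n%:R ^+ 2.
Proof.
move=> l0 [k0 kn nk] Hk j; case: (leqP n j) => [/eqP ->|jn].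
  by rewrite !mulr0 sqr_ge0.
suff [c [cn jc]] : exists c : R, lambda * c <= n%:R ^+ 2 /\ j%:R * (n - j)%:R <= c.
  by apply: le_trans cn; rewrite ler_pM2l.
rewrite natrB; last exact: ltnW.
case: (leqP (k + k) n) Hk => [kkn|nkk _]; last first.
  (* Here n <= 2 k - 1, and (k - j) (k - 1 - j) >= 0 because no integer lies strictly between k - 1
     and k. *)
  exists (k%:R * (k%:R - 1)); split=> //.
  have nkk' : n%:R + 1 <= k%:R + k%:R :> R by rewrite natr1 -natrD ler_nat.
  have j0 : 0 <= j%:R :> R by [].
  have : 0 <= (k%:R - j%:R) * (k%:R - 1 - j%:R) :> R.
    case: (ltnP j k) => [jk|kj].
      have : j%:R + 1 <= k%:R :> R by rewrite natr1 ler_nat.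
      by nra.
    have : k%:R <= j%:R :> R by rewrite ler_nat.
    by nra.
  by nra.
rewrite /= -ltNge => nk'.
exists (k%:R * (n%:R - k%:R)); split; first exact: ltW.
have kR : 0 < k%:R :> R by rewrite ltr0n.
have : k%:R * (n%:R - k%:R) < k%:R * (k%:R + 1) :> R.
  by rewrite -(ltr_pM2l l0); exact: lt_le_trans nk' nk.
rewrite ltr_pM2l// ltrBlDr => nkk.
(* Together with 2 k <= n, the bound n - k < k + 1 leaves only this case, where j (2 k - j) <=
   k^2. *)
have nE : n = (k + k)%N.
  by apply/eqP; rewrite eqn_leq kkn andbT -ltnS -(ltr_nat R) -natr1 natrD; lra.
by rewrite nE natrD; have := sqr_ge0 (k%:R - j%:R : R); nra.
Qed.

Lemma ROF_minimizer_exists lambda n : 1 < lambda -> (0 < n)%N ->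
  exists u : BV01 R, ROF_minimizer lambda (staircase n) u /\
    forall v : BV01 R, ROF_minimizer lambda (staircase n) v -> bv_eq v u.
Proof.
move=> l1 n0; have l0 : 0 < lambda by lra.
have [k tk] := threshold_exists l1 n0; have [k0 kn nk] := tk.
have [/andP[kkn nk']|/(threshold_sum_le l0 tk)] := boolP ((k + k <= n)%N &&
  (n%:R ^+ 2 <= lambda * (k%:R * (n%:R - k%:R)))); last exact: mean_minimizer.
have [u [u1 u2 _]] := clipped_minimizer l1 n0 k0 kkn kn nk nk'.
by exists u.
Qed.

(** Comparing k (k - 1) with (k - 1)^2 and k (k + 1) with (k + 1)^2, then taking roots, places n
    between (k - 1) sqrt lambda and (k + 1) sqrt lambda. *)
Lemma threshold_sqrt lambda n k : 0 < lambda -> threshold lambda n k ->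
  `|k%:R - n%:R / Num.sqrt lambda| <= 1.
Proof.
move=> l0 [k0 kn nk]; set s := Num.sqrt lambda.
have s0 : 0 < s by rewrite sqrtr_gt0.
have sE : lambda = s ^+ 2 by rewrite sqr_sqrtr// ltW.
have k1 : 1 <= k%:R :> R by rewrite ler1n.
have n0 : 0 <= n%:R :> R by [].
have H1 : (k%:R - 1) * s <= n%:R.
  rewrite -(@ler_pXn2r _ 2)//; last 1 first.
  - by rewrite nnegrE mulr_ge0 ?subr_ge0// ltW.
  apply: le_trans kn; rewrite exprMn -sE mulrC ler_pM2l//.
  by nra.
have H2 : n%:R <= (k%:R + 1) * s.
  rewrite -(@ler_pXn2r _ 2)//; last 1 first.
  - by rewrite nnegrE mulr_ge0 ?addr_ge0// ltW.
  apply: le_trans nk _; rewrite exprMn -sE mulrC ler_pM2r//.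
  by nra.
rewrite ler_norml lerBrDr lerBlDr.
rewrite -ler_pdivlMr// in H1; rewrite -ler_pdivrMr// in H2.
by apply/andP; split; lra.
Qed.

End Threshold.

Theorem theorem4p3 (R : realType) (lambda : R) (lambda_gt4 : 4 < lambda) :
  (forall n : nat, (0 < n)%N ->
    exists u : BV01 R, ROF_minimizer lambda (staircase n) u /\
      forall v : BV01 R, ROF_minimizer lambda (staircase n) v -> bv_eq v u) /\
  forall u : nat -> BV01 R,
    (forall n : nat, (0 < n)%N -> ROF_minimizer lambda (staircase n) (u n)) ->
    exists a b : nat -> R,
      [/\ a n @[n --> \oo] --> (Num.sqrt lambda)^-1,
          b n @[n --> \oo] --> 1 - (Num.sqrt lambda)^-1 &
          \forall n \near \oo,
            [/\ 0 < a n, a n < b n, b n < 1,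
                {ae (@lebesgue_measure R), forall x,
                  a n <= x -> x <= b n -> u n x = staircase n x} &
                (exists c : R, {ae (@lebesgue_measure R), forall x,
                   0 < x -> x < a n -> u n x = c}) /\
                (exists c : R, {ae (@lebesgue_measure R), forall x,
                   b n < x -> x < 1 -> u n x = c})]].
Proof.
have l1 : 1 < lambda by apply: lt_trans lambda_gt4; lra.
have l0 : 0 < lambda by apply: lt_trans l1.
split; first by move=> n n0; exact: ROF_minimizer_exists.
move=> u umin; pose s := Num.sqrt lambda.
have s0 : 0 < s by rewrite sqrtr_gt0.
have s2 : 2 < s.
  have s22 : (2 : R) = Num.sqrt (2 ^+ 2) by rewrite sqrtr_sqr ger0_norm.
  by rewrite s22 ltr_sqrt//; apply: le_lt_trans lambda_gt4; lra.
have /choice[k kP] : forall n, exists k, (0 < n)%N -> threshold lambda n k.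
  move=> n; case: (ltnP 0 n) => [n0|_]; last by exists 0%N.
  by have [k tk] := threshold_exists l1 n0; exists k.
have close n : (0 < n)%N -> `|node R n (k n) - s^-1| <= n%:R^-1.
  move=> n0; have n0R : 0 < n%:R :> R by rewrite ltr0n.
  have -> : node R n (k n) - s^-1 = ((k n)%:R - n%:R / s) / n%:R.
    by rewrite /node; field; rewrite !gt_eqF.
  rewrite normrM normfV (gtr0_norm n0R) ler_pdivrMr// mulVf ?gt_eqF//.
  exact: threshold_sqrt l0 (kP n n0).
have cvg_a : (fun n => node R n (k n)) @ \oo --> s^-1.
  apply/cvgrPdist_le => e e0; near=> n.
  have n0 : (0 < n)%N by near: n; exact: nbhs_infty_gt.
  rewrite distrC; apply: le_trans (close n n0) _.
  rewrite invf_ple ?posrE ?ltr0n//; apply: ltW.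
  by near: n; exact: nbhs_infty_gtr.
(* The ends of the middle block of cells, on which the truncation leaves the staircase unchanged. *)
exists (fun n => node R n (k n)), (fun n => 1 - node R n (k n)); split => //.
  by apply: cvgB => //; exact: cvg_cst.
near=> n.
have n0 : (0 < n)%N by near: n; exact: nbhs_infty_gt.
have n0R : 0 < n%:R :> R by rewrite ltr0n.
have tk := kP n n0; have [k0 kn nk] := tk.
have kR : 0 < (k n)%:R :> R by rewrite ltr0n.
(* This is where lambda > 4 enters: 2 k <= 2 n / s + 2 with s > 2, which is below n as soon as n (1
   - 2 / s) > 2. *)
have kkn : (k n + k n < n)%N.
  have big : (1 - 2 / s)^-1 * 2 < n%:R by near: n; exact: nbhs_infty_gtr.
  have c0 : 0 < 1 - 2 / s by rewrite subr_gt0 ltr_pdivrMr// mul1r.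
  rewrite mulrC ltr_pdivrMr// in big.
  have := threshold_sqrt l0 tk; rewrite -/s ler_norml => /andP[_ ks].
  rewrite -(ltr_nat R) natrD.
  have E : n%:R = n%:R * (1 - 2 / s) + 2 * (n%:R / s) :> R by ring.
  move: big ks E; set p := n%:R * (1 - 2 / s); set q := n%:R / s.
  by move=> big ks E; lra.
have nk' : n%:R ^+ 2 <= lambda * ((k n)%:R * (n%:R - (k n)%:R)).
  apply: le_trans nk _; rewrite ler_pM2l// ler_pM2l// lerBrDr.
  by rewrite addrAC -natrD natr1 ler_nat.
have klen : (k n <= n)%N by apply: leq_trans (ltnW kkn); exact: leq_addr.
have bE : 1 - node R n (k n) = node R n (n - k n).
  by rewrite /node natrB//; field; rewrite gt_eqF.
have [v [vmin vuniq vcell]] := clipped_minimizer l1 n0 k0 (ltnW kkn) kn nk nk'.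
have uv : bv_eq (u n) v by exact: vuniq (umin n n0).
have a0 : 0 < node R n (k n) by rewrite divr_gt0.
have aeF : Filter (nbhs (almost_everywhere (@lebesgue_measure R))).
  exact: ae_filter_ringOfSetsType.
rewrite bE; split.
- by [].
- by rewrite ltNge le_node// -ltnNge ltn_subRL.
- rewrite /node ltr_pdivrMr// mul1r ltr_nat -subn_gt0 subKn//.
(* The right end belongs to the next cell, where u is already truncated; being a single point, it is
   negligible. *)
- have bneg : {ae (@lebesgue_measure R), forall x, x != node R n (n - k n)}.
    exists [set node R n (n - k n)]; split => //.
      exact: lebesgue_measure_set1.
    by move=> x /= /negP; rewrite negbK => /eqP.
  apply: (filterS2 _ _ uv bneg) => x uvx xb ax; rewrite le_eqVlt (negbTE xb)/= => xb'.
  have x0 : 0 < x by apply: lt_le_trans ax.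
  have x1 : x < 1 by apply: lt_le_trans xb' _; rewrite -bE gerBl ltW.
  have [i leni /andP[ix xi]] := node_cell n0 (ltW x0) x1.
  rewrite uvx// (vcell i)// (staircase_cell n0 leni)// /clipped.
  have ki : (k n <= i)%N by rewrite -(node_le_cell n0 _ ix xi).
  have ink : (i < n - k n)%N.
    rewrite ltnNge -(node_le_cell n0 _ ix xi); apply/negP => H.
    by have := lt_le_trans xb' H; rewrite ltxx.
  by rewrite ltnNge ki/= ink.
- split; [exists (clip_level lambda n (k n))|exists (1 + n%:R^-1 - clip_level
  lambda n (k n))].
    apply: filterS uv => x uvx x0 xa.
    have x1 : x < 1 by apply: lt_le_trans xa _; rewrite node_le1.
    have [i leni /andP[ix xi]] := node_cell n0 (ltW x0) x1.
    rewrite uvx// (vcell i)// /clipped.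
    case: ltnP => //; rewrite -(node_le_cell n0 _ ix xi) => H.
    by have := lt_le_trans xa H; rewrite ltxx.
  apply: filterS uv => x uvx bx x1.
  have x0 : 0 < x by apply: le_lt_trans bx; exact: node_ge0.
  have [i leni /andP[ix xi]] := node_cell n0 (ltW x0) x1.
  have nki : (n - k n <= i)%N by rewrite -(node_le_cell n0 _ ix xi) ltW.
  have ki : (k n <= i)%N by apply: leq_trans nki; rewrite ltnW// ltn_subRL.
  by rewrite uvx// (vcell i)// /clipped !ltnNge ki nki.
Unshelve. all: by end_near. Qed.
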